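(* Let $(\mu^j_x)_{x,j}$ determine the spectral form of the Koopman representation associated with the boolean action of $L^0(\lambda,\mathbb{T})$ on $(X_\infty,\gamma_\infty)$ described in the context. Let $x_{1,0}\in\mathbb{N}[\mathbb{Z}^\times]$ be the function with domain $\{1\}$ and value $1$. Then for every $m\in\mathbb{Z}^\times$, $$ m\mu^1_{x_{1,0}}\preceq\mu^1_{x}\ \text{ for } x=m x_{1,0}\quad\Longleftrightarrow\quad m\in\{-1,1\}.$$
   Context: **Group.** $\mathbb{N}$ is the set of positive integers, $\mathbb{T}=\{z\in\mathbb{C}: |z|=1\}$, and $\lambda$ is the countable power on $2^{\mathbb{N}}=\{0,1\}^{\mathbb{N}}$ of the uniform measure on $\{0,1\}$. $L^0(\lambda,\mathbb{T})$ is the topological group of (classes modulo $\lambda$-null sets of) $\lambda$-measurable functions $2^{\mathbb{N}}\to\mathbb{T}$ with pointwise multiplication and the topology of convergence in measure. $\mu\preceq\nu$ means that $\mu$ is absolutely continuous with respect to $\nu$. **Index set.** $\mathbb{Z}^\times$ is the set of nonzero integers, a semigroup under multiplication; $\mathbb{N}[\mathbb{Z}^\times]$ is the set of all functions whose domain is a nonempty finite subset of $\mathbb{Z}^\times$ and whose values are in $\mathbb{N}$. For $x\in\mathbb{N}[\mathbb{Z}^\times]$ let $D(x)=\{(k,i): k\in\mathrm{dom}(x),\ 0\le i<x(k)\}$ and $C_x=(2^{\mathbb{N}})^{D(x)}$, with coordinate projections $\pi_{k,i}:C_x\to 2^{\mathbb{N}}$. A permutation $\delta$ of $D(x)$ is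 good if for each $(k,i)\in D(x)$, $\delta(k,i)=(k,j)$ for some $j$; it induces a good homeomorphism $\widetilde\delta$ of $C_x$ by $\pi_{\delta(k,i)}(\widetilde\delta(\alpha))=\pi_{k,i}(\alpha)$. **Action of $\mathbb{Z}^\times$.** For $x\in\mathbb{N}[\mathbb{Z}^\times]$ and $m\in\mathbb{Z}^\times$, $mx\in\mathbb{N}[\mathbb{Z}^\times]$ has domain $\{mn:n\in\mathrm{dom}(x)\}$ and $(mx)(n)=x(n/m)$. Let $e_{x,m}:C_x\to C_{mx}$ be the homeomorphism $e_{x,m}(a)(mk,i)=a(k,i)$. For a measure $\mu$ on $C_x$ compatible with $x$, $m\mu:=(e_{x,m})_*(\mu)$. **Compatible measures.** A finite Borel measure $\mu$ on $C_x$ is compatible with $x$ if (i) each marginal $(\pi_{k,i})_*(\mu)$ is absolutely continuous with respect to $\lambda$; (ii) $\mu$ is invariant under good homeomorphisms of $C_x$; (iii) for distinct $(k,i),(k',i')\in D(x)$ the set $\{\alpha\in C_x:\pi_{k,i}(\alpha)=\pi_{k',i'}(\alpha)\}$ is $\mu$-null. **Representations $\rho_\mu$.** For $\mu$ compatible with $x$, let $\widetilde{L^2}(\mu)$ be the closed subspace of $L^2(\mu)$ of functions invariant under all good homeomorphisms, and let $\rho_\mu$ be the unitary representation of $L^0(\lambda,\mathbb{T})$ on $\widetilde{L^2}(\mu)$ given by $\rho_\mu(\phi)(f)=\Big(\prod_{(k,i)\in D(x)}(\phi\circ\pi_{k,i})^k\Big) f$. (If $\mu=0$, this is the zero space.)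 **Spectral form.** Let $\xi$ be a unitary representation of $L^0(\lambda,\mathbb{T})$ on a separable Hilbert space $H$, and let $H_0$ be the orthogonal complement of the subspace of vectors fixed by $\xi$. It is known that there is a sequence of finite measures $(\mu^j_x)$, $x\in\mathbb{N}[\mathbb{Z}^\times]$, $j\in\mathbb{N}$, with $\mu^j_x$ compatible with $x$ and $\mu^{j+1}_x\preceq\mu^j_x$, such that $\xi$ restricted to $H_0$ is isomorphic to the $\ell^2$-sum over all $x,j$ of the representations $\rho_{\mu^j_x}$; these measures are unique up to mutual absolute continuity. This $\ell^2$-sum is the spectral form of $\xi$, and $(\mu^j_x)_{x,j}$ is said to determine the spectral form of $\xi$. **The boolean action.** $\gamma$ is the probability measure on $\mathbb{C}$ with density $\frac1\pi e^{-x^2-y^2}$ at $x+iy$. For $k\ge0$, $2^k$ is the set of binary sequences of length $k$, $\Sigma=\bigcup_{k\ge 0}2^k$, $|s|$ is the length of $s$, and juxtaposition is concatenation. $\gamma_k$ is the product measure on $\mathbb{C}^{2^k}$ with each coordinate carrying $\gamma$. Let $$X_\infty=\Big\{f\in\mathbb{C}^\Sigma:\ \forall s\in\Sigma\ \ f(s)=\tfrac{f(s0)+f(s1)}{\sqrt2}\Big\},$$ and let $\gamma_\infty$ be the unique probability measure on $X_\infty$ which, for each $k$, pushes forward to $\gamma_k$ under $f\mapsto f\restriction 2^k$. For $s\in 2^n$ let $[s]=\{a\in2^{\mathbb{N}}: a\restriction n=s\}$. $\mathbb{S}_n$ is the subgroup of $L^0(\lambda,\mathbb{T})$ of functions constant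 on each $[s]$, $s\in2^n$; for $g\in\mathbb{S}_n$ and a binary sequence $s$ with $|s|\ge n$, $g_s$ is the constant value of $g$ on $[s]$. $\mathbb{S}=\bigcup_n\mathbb{S}_n$ is a dense subgroup of $L^0(\lambda,\mathbb{T})$. For $g\in\mathbb{S}_n$ and $f\in X_\infty$ put $$(g\cdot f)(s)=\begin{cases} g_s f(s) & \text{if } |s|\ge n,\\ \frac{1}{\sqrt2^{\,k}}\sum_{t\in2^k}(g\cdot f)(st) & \text{if } |s|=n-k<n.\end{cases}$$ This defines an action of $\mathbb{S}$ on $X_\infty$ by $\gamma_\infty$-preserving transformations, hence a continuous embedding of $\mathbb{S}$ into the group $\mathrm{Aut}(\gamma_\infty)$ of measure preserving transformations of $\gamma_\infty$ (modulo null sets), which extends uniquely to a continuous embedding of $L^0(\lambda,\mathbb{T})$ into $\mathrm{Aut}(\gamma_\infty)$. This is the boolean action. The Koopman representation induced by a boolean action is the unitary representation on the complex space $L^2(\gamma_\infty)$ in which $g$ acts by composing functions with the measure preserving transformation given by $g^{-1}$. *)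

(* Defs.v *)
From HB Require Import structures.
From mathcomp Require Import all_boot all_order all_algebra all_fingroup.
From mathcomp Require Import finmap complex.
From mathcomp Require Import all_classical all_reals all_analysis.

Set Implicit Arguments.
Unset Strict Implicit.
Unset Printing Implicit Defensive.

Import Order.TTheory GRing.Theory Num.Theory.
Import ComplexField.Normc.

Local Open Scope classical_set_scope.
Local Open Scope complex_scope.
Local Open Scope ring_scope.

(* The sigma-algebra of a power T^I is generated by the coordinates.  For the
   (at most countable) powers of Polish spaces used below, it is the Borel
   sigma-algebra of the product topology. *)
Definition coord_sets (I : Type) d (T : measurableType d) : set (set (I -> T)) :=
  \bigcup_(i in [set: I])
    preimage_set_system setT (fun f : I -> T => f i) (@measurable d T).

Definition power (I : Type) d (T : measurableType d) : Type :=
  g_sigma_algebraType (@coord_sets I d T).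

HB.instance Definition _ (I : Type) d (T : measurableType d) :=
  Measurable.on (power I T).

(* Borel structure of the complex plane, transported from R * R. *)
Definition complex_pair (R : realType) (z : R[i]) : R * R :=
  (complex.Re z, complex.Im z).

HB.instance Definition _ (R : realType) := isPointed.Build R[i] 0.
HB.instance Definition _ (R : realType) :=
  Measurable.copy R[i] (g_sigma_algebra_preimageType (@complex_pair R)).

(* nu is the product measure P^I; for infinite I the sets below are the
   measurable rectangles with finitely many constrained coordinates. *)
Definition is_power_measure (R : realType) (I : choiceType) d
    (T : measurableType d) (P : set T -> \bar R) (nu : set (power I T) -> \bar R)
    : Prop :=
  forall (J : {fset I}) (A : I -> set T), (forall i, measurable (A i)) ->
    nu [set f | forall i, i \in J -> A i (f i)] = (\prod_(i <- J) P (A i))%E.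

Definition cantor : Type := power nat bool.
HB.instance Definition _ := Measurable.on cantor.

(* lam is the countable power of the uniform measure on {0, 1}. *)
Definition is_lambda (R : realType) (lam : probability cantor R) : Prop :=
  is_power_measure (bernoulli_prob (2^-1 : R)) lam.

(* Complex L^2.  Functions are not quotiented by a.e. equality: equality of
   vectors is [veq] below. *)

Definition cintegral (R : realType) d (T : measurableType d)
    (mu : {measure set T -> \bar R}) (f : T -> R[i]) : R[i] :=
  Rintegral mu setT (fun t => complex.Re (f t))
  +i* Rintegral mu setT (fun t => complex.Im (f t)).

Definition L2 (R : realType) d (T : measurableType d)
    (mu : {measure set T -> \bar R}) : set (T -> R[i]) :=
  [set f | measurable_fun setT f /\
           (\int[mu]_t ((normc (f t)) ^+ 2)%:E < +oo)%E].

Definition L2ip (R : realType) d (T : measurableType d)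
    (mu : {measure set T -> \bar R}) (f g : T -> R[i]) : R[i] :=
  cintegral mu (fun t => f t * (g t)^*).

(* Representatives of the elements of L^0(lambda, T).  The classes modulo
   lambda-null sets are those of equality lambda-a.e.; every class of
   lambda-measurable functions has a Borel representative. *)
Definition L0T (R : realType) : set (cantor -> R[i]) :=
  [set phi | measurable_fun setT phi /\ forall a, normc (phi a) = 1].

(* Data of a unitary representation of L^0(lambda, T).  The Hilbert space is
   the set [hilb] of vectors modulo the vectors of norm 0. *)
Record repr_data (R : realType) := ReprData {
  vec : lmodType R[i];
  hilb : set vec;
  ip : vec -> vec -> R[i];
  gact : (cantor -> R[i]) -> vec -> vec }.

Section Representations.
Variable R : realType.
Implicit Types H : repr_data R.

Definition sqnorm H (v : vec H) : R := complex.Re (ip v v).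

Definition veq H (v w : vec H) : Prop := sqnorm (v - w) = 0.

Definition fixed_vectors H : set (vec H) :=
  [set v | hilb v /\ forall phi, L0T phi -> veq (gact phi v) v].

(* The restriction of the representation to the orthogonal complement of its
   fixed vectors. *)
Definition nonfixed_part H : repr_data R :=
  {| vec := vec H;
     hilb := [set v | hilb v /\ forall w, fixed_vectors w -> ip v w = 0];
     ip := @ip R H;
     gact := @gact R H |}.

(* H is isomorphic to the l^2-sum of the K i: there is an equivariant
   surjective linear isometry U of H onto
   { (w i)_i | w i in K i, sum_i |w i|^2 < oo }. *)
Definition iso_l2sum H (I : choiceType) (K : I -> repr_data R) : Prop :=
  exists U : vec H -> forall i, vec (K i),
  [/\ forall v, hilb v -> forall i, hilb (U v i),
      forall (a : R[i]) v w, hilb v -> hilb w ->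
        forall i, veq (U (a *: v + w) i) (a *: U v i + U w i),
      forall v, hilb v ->
        (\esum_(i in [set: I]) (sqnorm (U v i))%:E = (sqnorm v)%:E)%E,
      forall w : forall i, vec (K i), (forall i, hilb (w i)) ->
        (\esum_(i in [set: I]) (sqnorm (w i))%:E < +oo)%E ->
        exists2 v, hilb v & forall i, veq (U v i) (w i)
    & forall phi, L0T phi -> forall v, hilb v ->
        forall i, veq (U (gact phi v) i) (gact phi (U v i))].

End Representations.

(* N[Z^x]: a function with finite domain and positive values is represented by
   its extension by 0, so that its domain is its support. *)
Definition is_idx (x : {fsfun int -> nat with 0%N}) : bool :=
  (x 0 == 0%N) && (finsupp x != fset0).

Definition idx : Type := {x : {fsfun int -> nat with 0%N} | is_idx x}.
HB.instance Definition _ := Choice.on idx.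

Definition dom (x : idx) : {fset int} := finsupp (val x).

Definition D (x : idx) : {fset int * nat} :=
  [fset ((k, i) : int * nat) | k in dom x, i in iota 0 (val x k)]%fset.

Lemma in_D (x : idx) (p : int * nat) : (p \in D x) = (p.2 < val x p.1)%N.
Proof.
case: p => k i; apply/imfset2P/idP => /=.
  by move=> [k' _ [i' + [-> ->]]]; rewrite mem_iota.
move=> ik; exists k; first by rewrite /= mem_finsupp -lt0n (leq_ltn_trans _ ik).
by exists i; rewrite //= mem_iota.
Qed.

Definition C_ (x : idx) : Type := power (D x) cantor.
HB.instance Definition _ (x : idx) := Measurable.on (C_ x).

(* The coordinate projection pi_{k,i} is evaluation at (k, i). *)
Definition proj (x : idx) (p : D x) (a : C_ x) : cantor := a p.

Definition good (x : idx) (delta : {perm D x}) : Prop :=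
  forall p : D x, (val (delta p)).1 = (val p).1.

(* pi_{delta p} (good_homeo delta a) = pi_p a. *)
Definition good_homeo (x : idx) (delta : {perm D x}) (a : C_ x) : C_ x :=
  fun q => a ((delta^-1)%g q).

Definition Zx : Type := {m : int | m != 0}.

Definition zmul_fsfun (m : Zx) (x : idx) : {fsfun int -> nat with 0%N} :=
  [fsfun n in [fset val m * k | k in dom x]%fset => val x (n %/ val m)%Z].

Lemma zmul_fsfun_mul (m : Zx) (x : idx) (k : int) :
  zmul_fsfun m x (val m * k) = val x k.
Proof.
have m0 := valP m.
rewrite fsfun_fun mulKz //; case: ifPn => // /imfsetP kx.
have [kd|/fsfun_dflt ->//] := boolP (k \in finsupp (val x)).
by exfalso; apply: kx; exists k.
Qed.

Lemma zmul_fsfun_neq0 (m : Zx) (x : idx) (n : int) : zmul_fsfun m x n != 0%N ->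
  n = val m * (n %/ val m)%Z.
Proof.
rewrite fsfun_fun; case: ifPn => // /imfsetP [k /= _ ->] _.
by rewrite mulKz // (valP m).
Qed.

Lemma zmul_subproof (m : Zx) (x : idx) : is_idx (zmul_fsfun m x).
Proof.
rewrite /is_idx; have /andP[x0 /fset0Pn [k kx]] := valP x.
rewrite -(mulr0 (val m)) zmul_fsfun_mul x0 /=; apply/fset0Pn.
by exists (val m * k); rewrite mem_finsupp zmul_fsfun_mul -mem_finsupp.
Qed.

Definition zmul (m : Zx) (x : idx) : idx := exist is_idx _ (zmul_subproof m x).

Lemma zmulE (m : Zx) (x : idx) (k : int) :
  val (zmul m x) (val m * k) = val x k.
Proof. exact: zmul_fsfun_mul. Qed.

Lemma zdiv_in_D (m : Zx) (x : idx) (q : D (zmul m x)) :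
  (((val q).1 %/ val m)%Z, (val q).2) \in D x.
Proof.
have := valP q; rewrite !in_D /= => h.
have /zmul_fsfun_neq0 E : zmul_fsfun m x (val q).1 != 0%N.
  by rewrite -lt0n (leq_ltn_trans _ h).
by rewrite -(zmul_fsfun_mul m) -E.
Qed.

(* e_{x,m} (a) (m k, i) = a (k, i). *)
Definition e_ (x : idx) (m : Zx) (a : C_ x) : C_ (zmul m x) :=
  fun q => a [` zdiv_in_D q ]%fset.

Definition x10_fsfun : {fsfun int -> nat with 0%N} :=
  [fsfun n in [fset (1 : int)]%fset => 1%N].

Lemma x10_subproof : is_idx x10_fsfun.
Proof.
apply/andP; split; first by rewrite fsfun_fun inE.
by apply/fset0Pn; exists 1; rewrite mem_finsupp fsfun_fun inE eqxx.
Qed.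

Definition x10 : idx := exist is_idx _ x10_subproof.

Section SpectralForm.
Variables (R : realType) (lam : probability cantor R).

Definition compatible (x : idx) (mu : {finite_measure set (C_ x) -> \bar R})
    : Prop :=
  [/\ forall p : D x, pushforward mu (proj p) `<< lam,
      forall delta : {perm D x}, good delta ->
        forall A : set (C_ x), measurable A ->
          pushforward mu (good_homeo delta) A = mu A
    & forall p q : D x, p != q -> mu.-negligible [set a | proj p a = proj q a]].

Definition rho (x : idx) (mu : {finite_measure set (C_ x) -> \bar R})
    : repr_data R :=
  {| vec := (C_ x -> R[i]);
     hilb := [set f | L2 mu f /\ forall delta : {perm D x}, good delta ->
                        f \o good_homeo delta = f %[ae mu]];
     ip := L2ip mu;
     gact := fun phi f a =>
       (\prod_(p : D x) (phi (proj p a)) ^ ((val p).1)) * f a |}.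

(* [mu x j] is the measure mu^{j+1}_x: the index j is shifted to start at 0. *)
Definition determines_spectral_form (xi : repr_data R)
    (mu : forall x : idx, nat -> {finite_measure set (C_ x) -> \bar R}) : Prop :=
  [/\ forall x j, compatible (mu x j),
      forall x j, mu x j.+1 `<< mu x j
    & iso_l2sum (nonfixed_part xi) (fun p : idx * nat => rho (mu p.1 p.2))].

End SpectralForm.

Section BooleanAction.
Variable R : realType.

Definition gamma (A : set R[i]) : \bar R :=
  (\int[lebesgue_measure \x lebesgue_measure]_(p in [set p : R * R | A (p.1 +i* p.2)])
     (pi^-1 * expR (- p.1 ^+ 2 - p.2 ^+ 2))%:E)%E.

Definition Xinf_set : set (power (seq bool) R[i]) :=
  [set f | forall s : seq bool,
     f s = (f (rcons s false) + f (rcons s true)) / (Num.sqrt 2)%:C].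

Lemma Xinf_set0 : (fun=> 0) \in Xinf_set.
Proof. by rewrite inE /Xinf_set /= => s; rewrite addr0 mul0r. Qed.

Definition Xinf_pre : Type := set_type Xinf_set.
HB.instance Definition _ := Choice.on Xinf_pre.
HB.instance Definition _ := isPointed.Build Xinf_pre
  (exist (fun f => f \in Xinf_set) _ Xinf_set0).

Definition Xval (f : Xinf_pre) : power (seq bool) R[i] := val f.

(* X_infty with the trace of the sigma-algebra of C^Sigma. *)
Definition Xinf : Type := g_sigma_algebra_preimageType Xval.
HB.instance Definition _ := Measurable.on Xinf.

Definition restr (k : nat) (f : Xinf) : power (k.-tuple bool) R[i] :=
  fun s => Xval f s.

Definition is_gamma_inf (gam : probability Xinf R) : Prop :=
  forall k : nat, is_power_measure gamma (pushforward gam (@restr k)).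

Definition SS (n : nat) : set (cantor -> R[i]) :=
  [set g | L0T g /\
    forall a b : cantor, (forall i, (i < n)%N -> a i = b i) -> g a = g b].

(* The value g_s of g in SS n on [s], for |s| >= n. *)
Definition gval (g : cantor -> R[i]) (s : seq bool) : R[i] :=
  g (fun i => nth false s i).

(* The coordinates of g . f, for g in SS n. *)
Definition dyadic_act (n : nat) (g : cantor -> R[i]) (f : seq bool -> R[i])
    (s : seq bool) : R[i] :=
  if (n <= size s)%N then gval g s * f s
  else let k := (n - size s)%N in
    ((Num.sqrt 2)%:C ^+ k)^-1 *
      \sum_(t : k.-tuple bool) gval g (s ++ t) * f (s ++ t).

(* alpha induces the continuous embedding of L^0(lambda, T) into
   Aut(gamma_infty) extending the action of the dyadic step functions.  The
   topology of Aut(gamma_infty) is the weak one, given by the pseudometrics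
   gamma_infty (S^-1 A (+) T^-1 A) for A measurable. *)
Record boolean_action (lam : probability cantor R) (gam : probability Xinf R)
    (alpha : (cantor -> R[i]) -> Xinf -> Xinf) : Prop := BooleanAction {
  ba_measurable : forall phi, L0T phi -> measurable_fun setT (alpha phi);
  ba_preserving : forall phi, L0T phi -> forall A : set Xinf, measurable A ->
    gam (alpha phi @^-1` A) = gam A;
  ba_morph : forall phi psi, L0T phi -> L0T psi ->
    alpha (fun a => phi a * psi a) = alpha phi \o alpha psi %[ae gam];
  ba_inj : forall phi psi, L0T phi -> L0T psi ->
    (alpha phi = alpha psi %[ae gam]) <-> (phi = psi %[ae lam]);
  ba_continuous : forall phi, L0T phi -> forall A : set Xinf, measurable A ->
    forall eps : R, 0 < eps -> exists2 delta : R, 0 < delta &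
    forall psi, L0T psi ->
      (lam [set a | (delta <= normc (psi a - phi a))%R] < delta%:E)%E ->
      (gam ((alpha psi @^-1` A) `+` (alpha phi @^-1` A)) < eps%:E)%E;
  ba_extends : forall n g, SS n g ->
    \forall f \ae gam, forall s, Xval (alpha g f) s = dyadic_act n g (Xval f) s }.

Definition koopman (gam : probability Xinf R)
    (alpha : (cantor -> R[i]) -> Xinf -> Xinf) : repr_data R :=
  {| vec := (Xinf -> R[i]);
     hilb := L2 gam;
     ip := L2ip gam;
     gact := fun phi F => F \o alpha (fun a => (phi a)^-1) |}.

End BooleanAction.

(* Main.v *)
Require Import Defs.
From HB Require Import structures.
From mathcomp Require Import all_boot all_order all_algebra all_fingroup.
From mathcomp Require Import finmap complex.
From mathcomp Require Import all_classical all_reals all_analysis.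
From mathcomp Require Import measurable_realfun.
From mathcomp Require Import ring lra.

Set Implicit Arguments.
Unset Strict Implicit.
Unset Printing Implicit Defensive.

Import Order.TTheory GRing.Theory Num.Theory.
Import ComplexField.Normc.

Local Open Scope classical_set_scope.
Local Open Scope complex_scope.
Local Open Scope ring_scope.

(** Put [k = -1] or [k = 1]. The coordinate of [f] at the empty sequence (for
    [k = -1]) or its conjugate (for [k = 1]) is, for every [n], the sum of its
    parts over the [2 ^ n] cylinders of level [n], and a step function of level
    [n] multiplies the part over a cylinder by the [k]-th power of its value
    there. On the spectral side such a part can only live on points whose
    weights, counted over the cylinders of every finer level, add up to [k] over
    one cylinder and to [0] over the others. The coordinates of almost every
    point are distinct, so long prefixes separate them, and the point must have
    a single coordinate, of weight [k], in the given cylinder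
    ([U_chaos1_supp]). Since the spectral map is an isometry, the squared moduli
    of the components give to each cylinder a fixed positive multiple of its
    measure under [lam]. Their sum is therefore a multiple of [lam], and as
    the first spectral measure over an index dominates the following ones, it
    dominates [lam] when the index is [k x10] ([lambda_dominated]). Compatibility
    says that [mu x10 0] is dominated by [lam]; this proves one implication
    and also that [mu x10 0] is not zero.

    For the other implication let [m] be different from [-1], [0] and [1]; the
    claim is that the first spectral measure over [m x10] is zero. The constant
    function 1 over this index corresponds to a vector [v] that is, for each
    [n], the sum of [2 ^ n] vectors [v t], on which step functions of level [n]
    act by the [m]-th power of their value over the cylinder of [t]. Let [P] be
    a smooth bounded function of finitely many coordinates. Average [P] over the
    rotations over [t] by the powers of a point [d] of the circle, with the
    coefficients of [(X - 1) (X - d) (X - d^-1)] as weights. The inner product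
    with [v t] is multiplied by the value of this polynomial at [d ^ m], which
    is not zero for suitable [d]. But the average annihilates constants and
    real-linear terms, and the coordinate at [t] enters [P] with the factor
    [2 ^- (n / 2)]: the average is of size [2 ^- n], and its squared norm of size
    [4 ^- n]. Summing over the [2 ^ n] sequences [t] gives that [v] is
    orthogonal to [P] ([ip_testP0]). Indicators of rectangles are limits of such
    functions, so [v = 0] ([L2_testP0]). *)

(** * Measurability and integration of complex functions *)

Section ComplexMeasurability.
Context (R : realType) d (T : measurableType d).
Implicit Types f g : T -> R[i].

Lemma measurable_complex_pair :
  measurable_fun setT (@complex_pair R : R[i] -> R * R).
Proof. by move=> _ B mB; rewrite setTI; exists B => //; rewrite setTI. Qed.

Lemma measurable_ReIm f : measurable_fun setT f <->
  measurable_fun setT (fun t => complex.Re (f t)) /\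
  measurable_fun setT (fun t => complex.Im (f t)).
Proof.
split=> [mf|[mr mi]].
  have mp : measurable_fun setT (fun t => complex_pair (f t)).
    exact: measurableT_comp measurable_complex_pair mf.
  by split; [exact: measurableT_comp (@measurable_fst _ _ _ _) mp
            |exact: measurableT_comp (@measurable_snd _ _ _ _) mp].
move=> _ A [B mB <-]; rewrite !setTI.
have mp : measurable_fun setT (fun t => (complex.Re (f t), complex.Im (f t))).
  exact: measurable_fun_pair.
by have := mp measurableT B mB; rewrite setTI.
Qed.

Lemma cReD (x y : R[i]) : complex.Re (x + y) = complex.Re x + complex.Re y.
Proof. by case: x => a b; case: y. Qed.
Lemma cImD (x y : R[i]) : complex.Im (x + y) = complex.Im x + complex.Im y.
Proof. by case: x => a b; case: y. Qed.
Lemma cReM (x y : R[i]) : complex.Re (x * y) =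
  complex.Re x * complex.Re y - complex.Im x * complex.Im y.
Proof. by case: x => a b; case: y. Qed.
Lemma cImM (x y : R[i]) : complex.Im (x * y) =
  complex.Re x * complex.Im y + complex.Im x * complex.Re y.
Proof. by case: x => a b; case: y. Qed.

Lemma measurable_addC f g : measurable_fun setT f -> measurable_fun setT g ->
  measurable_fun setT (fun t => f t + g t).
Proof.
move=> /measurable_ReIm[fr fi] /measurable_ReIm[gr gi]; apply/measurable_ReIm.
split.
  by under eq_fun do rewrite cReD; exact: measurable_funD.
by under eq_fun do rewrite cImD; exact: measurable_funD.
Qed.

Lemma measurable_mulC f g : measurable_fun setT f -> measurable_fun setT g ->
  measurable_fun setT (fun t => f t * g t).
Proof.
move=> /measurable_ReIm[fr fi] /measurable_ReIm[gr gi]; apply/measurable_ReIm.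
split.
  by under eq_fun do rewrite cReM; apply: measurable_funB; exact: measurable_funM.
by under eq_fun do rewrite cImM; apply: measurable_funD; exact: measurable_funM.
Qed.

Lemma cReJ (x : R[i]) : complex.Re x^* = complex.Re x.
Proof. by case: x. Qed.
Lemma cImJ (x : R[i]) : complex.Im x^* = - complex.Im x.
Proof. by case: x. Qed.

Lemma measurable_conjC f : measurable_fun setT f ->
  measurable_fun setT (fun t => (f t)^*).
Proof.
move=> /measurable_ReIm[fr fi]; apply/measurable_ReIm; split.
  by under eq_fun do rewrite cReJ.
by under eq_fun do rewrite cImJ; exact: measurable_funN.
Qed.

Lemma measurable_prodC (I : Type) (s : seq I) (F : I -> T -> R[i]) :
  (forall i, measurable_fun setT (F i)) ->
  measurable_fun setT (fun t => \prod_(i <- s) F i t).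
Proof.
move=> mF; elim: s => [|i s ih].
  by under eq_fun do rewrite big_nil; exact: measurable_cst.
by under eq_fun do rewrite big_cons; exact: measurable_mulC.
Qed.

Lemma sqr_normcE (z : R[i]) :
  normc z ^+ 2 = complex.Re z ^+ 2 + complex.Im z ^+ 2.
Proof.
by case: z => a b; rewrite /= sqr_sqrtr // addr_ge0 ?sqr_ge0.
Qed.

Lemma normc_ge0 (z : R[i]) : 0 <= normc z.
Proof. by case: z => a b; exact: sqrtr_ge0. Qed.

Lemma normcX (z : R[i]) n : normc (z ^+ n) = normc z ^+ n.
Proof.
elim: n => [|n ih]; first by rewrite !expr0 normc1.
by rewrite !exprS normcM ih.
Qed.

Lemma normc_conj (z : R[i]) : normc z^* = normc z.
Proof. by case: z => a b; rewrite /= sqrrN. Qed.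

Lemma mulcJ (z : R[i]) : z * z^* = (normc z ^+ 2)%:C.
Proof.
rewrite sqr_normcE; case: z => a b /=; apply/eqP; rewrite eq_complex /=.
by apply/andP; split; apply/eqP; ring.
Qed.

Lemma measurable_sqr_normc f : measurable_fun setT f ->
  measurable_fun setT (fun t => normc (f t) ^+ 2).
Proof.
move=> /measurable_ReIm[fr fi]; under eq_fun do rewrite sqr_normcE.
by apply: measurable_funD; exact: measurable_funX.
Qed.

End ComplexMeasurability.

Section ComplexIntegral.
Context (R : realType) d (T : measurableType d).
Variable mu : {measure set T -> \bar R}.
Implicit Types f g h : T -> R[i].

Definition integrableC f :=
  mu.-integrable setT (fun t => (complex.Re (f t))%:E) /\
  mu.-integrable setT (fun t => (complex.Im (f t))%:E).

Lemma le_integrableR (u v : T -> R) : measurable_fun setT u ->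
  (forall t, `|u t| <= v t) -> mu.-integrable setT (EFin \o v) ->
  mu.-integrable setT (EFin \o u).
Proof.
move=> mu_ uv iv; apply: (le_integrable _ _ _ iv) => //.
  exact/measurable_EFinP.
move=> t _ /=; rewrite lee_fin; apply: (le_trans (uv t)).
exact: ler_norm.
Qed.

Lemma integrableRD (u v : T -> R) : mu.-integrable setT (EFin \o u) ->
  mu.-integrable setT (EFin \o v) ->
  mu.-integrable setT (EFin \o (fun t => u t + v t)).
Proof. by move=> iu iv; have := integrableD measurableT iu iv; exact. Qed.

Lemma integrableRZ (c : R) (u : T -> R) : mu.-integrable setT (EFin \o u) ->
  mu.-integrable setT (EFin \o (fun t => c * u t)).
Proof. by move=> iu; have := integrableZl measurableT c iu; exact. Qed.

Lemma L2_integrable f : L2 mu f ->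
  mu.-integrable setT (EFin \o (fun t => normc (f t) ^+ 2)).
Proof.
move=> [mf fi]; apply/integrableP; split.
  by apply/measurable_EFinP; exact: measurable_sqr_normc.
apply: le_lt_trans fi; rewrite le_eqVlt; apply/orP; left; apply/eqP.
by apply: eq_integral => t _ /=; rewrite ger0_norm ?sqr_ge0.
Qed.

Lemma integrable_L2 f : measurable_fun setT f ->
  mu.-integrable setT (EFin \o (fun t => normc (f t) ^+ 2)) -> L2 mu f.
Proof.
move=> mf /integrableP[_ fi]; split=> //.
apply: le_lt_trans fi; rewrite le_eqVlt; apply/orP; left; apply/eqP.
by apply: eq_integral => t _ /=; rewrite ger0_norm ?sqr_ge0.
Qed.

Lemma integrableC_mulJ f g : L2 mu f -> L2 mu g ->
  integrableC (fun t => f t * (g t)^*).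
Proof.
move=> fL gL.
have /measurable_ReIm[mr mi] : measurable_fun setT (fun t => f t * (g t)^*).
  by apply: measurable_mulC; [case: fL|apply: measurable_conjC; case: gL].
have Ifg := integrableRD (L2_integrable fL) (L2_integrable gL); split.
  apply: (le_integrableR (v := fun t => normc (f t) ^+ 2 + normc (g t) ^+ 2)) => //.
  move=> t; rewrite cReM cReJ cImJ !sqr_normcE ler_norml.
  move: (complex.Re _) (complex.Im _) (complex.Re _) (complex.Im _) => a b c e.
  have := (sqr_ge0 (a - c), sqr_ge0 (a + c), (sqr_ge0 (b - e), sqr_ge0 (b + e))).
  by move=> [[h1 h2] [h3 h4]]; apply/andP; split; nra.
apply: (le_integrableR (v := fun t => normc (f t) ^+ 2 + normc (g t) ^+ 2)) => //.
move=> t; rewrite cImM cReJ cImJ !sqr_normcE ler_norml.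
move: (complex.Re _) (complex.Im _) (complex.Re _) (complex.Im _) => a b c e.
have := (sqr_ge0 (a - e), sqr_ge0 (a + e), (sqr_ge0 (b - c), sqr_ge0 (b + c))).
by move=> [[h1 h2] [h3 h4]]; apply/andP; split; nra.
Qed.

Lemma L2_dominated f g (C : R) : L2 mu f -> measurable_fun setT g ->
  (forall t, normc (g t) ^+ 2 <= C * normc (f t) ^+ 2) -> L2 mu g.
Proof.
move=> fL mg gf; apply: integrable_L2 => //.
apply: (le_integrableR (v := fun t => C * normc (f t) ^+ 2)).
- exact: measurable_sqr_normc.
- by move=> t; rewrite ger0_norm ?sqr_ge0.
- by apply: integrableRZ; exact: L2_integrable.
Qed.

Lemma L2_lin (a : R[i]) f g : L2 mu f -> L2 mu g ->
  L2 mu (fun t => a * f t + g t).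
Proof.
move=> fL gL; apply: integrable_L2.
  apply: measurable_addC; last by case: gL.
  by apply: measurable_mulC; [exact: measurable_cst | case: fL].
apply: (le_integrableR (v := fun t => (2 * normc a ^+ 2) * normc (f t) ^+ 2 +
   2 * normc (g t) ^+ 2)).
- apply: measurable_sqr_normc; apply: measurable_addC; last by case: gL.
  by apply: measurable_mulC; [exact: measurable_cst | case: fL].
- move=> t; rewrite ger0_norm ?sqr_ge0 // -(mulrA 2) -exprMn -normcM.
  move: (a * f t) (g t) => x y; rewrite !sqr_normcE cReD cImD.
  move: (complex.Re _) (complex.Im _) (complex.Re _) (complex.Im _) => p q r s.
  have : 0 <= (p - r) ^+ 2 by exact: sqr_ge0.
  have : 0 <= (q - s) ^+ 2 by exact: sqr_ge0.
  by nra.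
- by apply: integrableRD; apply: integrableRZ; exact: L2_integrable.
Qed.

Lemma L2_0 : L2 mu (fun=> 0).
Proof.
split; first exact: measurable_cst.
by under eq_integral do rewrite normc0 expr0n /=; rewrite integral0.
Qed.

Lemma L2Z (a : R[i]) f : L2 mu f -> L2 mu (fun t => a * f t).
Proof.
move=> fL; have := L2_lin a fL L2_0.
by under eq_fun do rewrite addr0.
Qed.

Lemma L2B f g : L2 mu f -> L2 mu g -> L2 mu (fun t => f t - g t).
Proof.
move=> fL gL; have := L2_lin (-1) gL fL.
by under eq_fun do rewrite mulN1r addrC.
Qed.

Lemma L2_sum (I : Type) (s : seq I) (F : I -> T -> R[i]) :
  (forall i, L2 mu (F i)) -> L2 mu (fun t => \sum_(i <- s) F i t).
Proof.
move=> FL; elim: s => [|i s ih].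
  by under eq_fun do rewrite big_nil; exact: L2_0.
under eq_fun do rewrite big_cons.
have := L2_lin 1 (FL i) ih.
by under eq_fun do rewrite mul1r.
Qed.

Lemma cintegralD f g : integrableC f -> integrableC g ->
  cintegral mu (fun t => f t + g t) = cintegral mu f + cintegral mu g.
Proof.
move=> [fr fi] [gr gi]; rewrite /cintegral.
under eq_Rintegral do rewrite cReD.
under [X in _ +i* X]eq_Rintegral do rewrite cImD.
by rewrite !RintegralD.
Qed.

Lemma integrableCD f g : integrableC f -> integrableC g ->
  integrableC (fun t => f t + g t).
Proof.
move=> [fr fi] [gr gi]; split.
  by under eq_fun do rewrite cReD EFinD; exact: integrableD.
by under eq_fun do rewrite cImD EFinD; exact: integrableD.
Qed.

Lemma integrableCZ (a : R[i]) f : integrableC f ->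
  integrableC (fun t => a * f t).
Proof.
move=> [fr fi]; split.
  under eq_fun do rewrite cReM EFinB !EFinM.
  by apply: integrableB => //; exact: integrableZl.
under eq_fun do rewrite cImM EFinD !EFinM.
by apply: integrableD => //; exact: integrableZl.
Qed.

Lemma cintegralZ (a : R[i]) f : integrableC f ->
  cintegral mu (fun t => a * f t) = a * cintegral mu f.
Proof.
move=> [fr fi]; rewrite /cintegral; case: a => a b.
under eq_Rintegral do rewrite cReM /=.
under [X in _ +i* X]eq_Rintegral do rewrite cImM /=.
by rewrite RintegralB ?RintegralD ?RintegralZl //; exact: integrableRZ.
Qed.

Lemma integrableC_sum (I : Type) (s : seq I) (F : I -> T -> R[i]) :
  (forall i, integrableC (F i)) -> integrableC (fun t => \sum_(i <- s) F i t).
Proof.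
move=> FL; elim: s => [|i s ih].
  under eq_fun do rewrite big_nil.
  by split; exact: integrable0.
by under eq_fun do rewrite big_cons; exact: integrableCD.
Qed.

Lemma cintegral_sum (I : Type) (s : seq I) (F : I -> T -> R[i]) :
  (forall i, integrableC (F i)) ->
  cintegral mu (fun t => \sum_(i <- s) F i t) =
  \sum_(i <- s) cintegral mu (F i).
Proof.
move=> FL; elim: s => [|i s ih].
  under [X in cintegral _ X]eq_fun do rewrite big_nil.
  by rewrite big_nil /cintegral /= /Rintegral integral0.
under [X in cintegral _ X]eq_fun do rewrite big_cons.
by rewrite big_cons cintegralD ?ih //; exact: integrableC_sum.
Qed.

Lemma L2ip_lin (a : R[i]) f g h : L2 mu f -> L2 mu g -> L2 mu h ->
  L2ip mu (fun t => a * f t + g t) h = a * L2ip mu f h + L2ip mu g h.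
Proof.
move=> fL gL hL; rewrite /L2ip.
under [X in cintegral _ X]eq_fun do rewrite mulrDl -mulrA.
rewrite cintegralD ?cintegralZ //; try exact: integrableC_mulJ.
by apply: integrableCZ; exact: integrableC_mulJ.
Qed.

Lemma Re_L2ip f : complex.Re (L2ip mu f f) =
  Rintegral mu setT (fun t => normc (f t) ^+ 2).
Proof.
rewrite /L2ip /cintegral /=.
by under eq_Rintegral do rewrite mulcJ /=.
Qed.

Lemma L2_aeP f g : L2 mu f -> L2 mu g ->
  Rintegral mu setT (fun t => normc (f t - g t) ^+ 2) = 0 <->
  \forall t \ae mu, f t = g t.
Proof.
move=> fL gL; have dL := L2B fL gL.
have mm : measurable_fun setT (fun t => (normc (f t - g t) ^+ 2)%:E).
  by apply/measurable_EFinP; apply: measurable_sqr_normc; case: dL.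
have E : (\int[mu]_t `|(normc (f t - g t) ^+ 2)%:E| =
          (Rintegral mu setT (fun t => normc (f t - g t) ^+ 2))%:E)%E.
  rewrite /Rintegral fineK; last first.
    by apply: integrable_fin_num => //; exact: L2_integrable.
  by apply: eq_integral => t _; rewrite gee0_abs // lee_fin sqr_ge0.
split=> [r0|ae].
  have /ae_eq_integral_abs : (\int[mu]_t `|(normc (f t - g t) ^+ 2)%:E| = 0)%E.
    by rewrite E r0.
  move=> /(_ measurableT mm); apply: filterS => t /(_ I) [] /eqP.
  by rewrite sqrf_eq0 => /eqP /eq0_normc /eqP; rewrite subr_eq0 => /eqP.
suff: (Rintegral mu setT (fun t => normc (f t - g t) ^+ 2))%:E = 0%E by case.
rewrite -E; apply/ae_eq_integral_abs => //.
by apply: filterS ae => t -> _; rewrite subrr normc0 expr0n.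
Qed.

Lemma le_cintegral f (u : T -> R) : integrableC f ->
  mu.-integrable setT (EFin \o u) -> (forall t, normc (f t) <= u t) ->
  normc (cintegral mu f) <= 2 * Rintegral mu setT u.
Proof.
move=> [fr fi] iu fu.
have h (v : T -> R) : mu.-integrable setT (EFin \o v) ->
    (forall t, `|v t| <= normc (f t)) -> `|Rintegral mu setT v| <= Rintegral mu setT u.
  move=> iv vf; apply: (le_trans (le_normr_Rintegral _ _)) => //.
  apply: le_Rintegral => //; first exact: integrable_norm.
  by move=> t _; apply: le_trans (fu t).
have cz (z : R[i]) : normc z <= `|complex.Re z| + `|complex.Im z|.
  rewrite -(@ler_pXn2r _ 2) ?nnegrE ?normc_ge0 ?addr_ge0 //.
  rewrite sqr_normcE -(real_normK (num_real (complex.Re z))) -(real_normK (num_real (complex.Im z))).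
  have := normr_ge0 (complex.Re z); have := normr_ge0 (complex.Im z); nra.
have rz (z : R[i]) : `|complex.Re z| <= normc z /\ `|complex.Im z| <= normc z.
  have := normc_ge0 z; have := sqr_normcE z.
  have := sqr_ge0 (complex.Re z); have := sqr_ge0 (complex.Im z) => h1 h2 h3 h4.
  by split; rewrite -(@ler_pXn2r _ 2) ?nnegrE ?normr_ge0 // real_normK ?num_real // h3; lra.
apply: (le_trans (cz _)) => /=; rewrite mulr2n mulrDl mul1r; apply: lerD.
  by apply: h => // t; case: (rz (f t)).
by apply: h => // t; case: (rz (f t)).
Qed.

End ComplexIntegral.

(** * Measure-preserving maps, coordinates and characters *)

Section Preserving.
Context (R : realType) d (T : measurableType d).
Variable mu : {measure set T -> \bar R}.
Variable tau : T -> T.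
Hypothesis mtau : measurable_fun setT tau.
Hypothesis ptau : forall A, measurable A -> mu (tau @^-1` A) = mu A.

Lemma preserving_integrable (u : T -> R) : mu.-integrable setT (EFin \o u) ->
  mu.-integrable setT (EFin \o (fun t => u (tau t))) /\
  Rintegral mu setT (fun t => u (tau t)) = Rintegral mu setT u.
Proof.
move=> iu.
have mu_ : measurable_fun setT (EFin \o u) by case/integrableP : iu.
have E (v : T -> \bar R) : (\int[pushforward mu tau]_t v t = \int[mu]_t v t)%E.
  by apply: eq_measure_integral => A mA _; exact: ptau.
have iut : mu.-integrable setT (EFin \o u \o tau).
  apply/integrableP; split; first exact: measurableT_comp mu_ mtau.
  have mau : measurable_fun setT (abse \o (EFin \o u)) by exact: measurableT_comp.
  have := ge0_integral_pushforward mtau mu measurableT mau.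
  rewrite preimage_setT => <-; last by move=> ? _; exact: abse_ge0.
  by rewrite E; case/integrableP : iu.
split; first exact: iut.
rewrite /Rintegral -[in RHS]E; congr fine.
by rewrite (integral_pushforward mtau) ?preimage_setT.
Qed.

Lemma preserving_L2 f : L2 mu f -> L2 mu (fun t => f (tau t)).
Proof.
move=> fL; apply: integrable_L2; first by apply: measurableT_comp => //; case: fL.
by case: (preserving_integrable (L2_integrable fL)).
Qed.

Lemma preserving_cintegral (f : T -> R[i]) : integrableC mu f ->
  cintegral mu (fun t => f (tau t)) = cintegral mu f.
Proof.
move=> [fr fi]; rewrite /cintegral.
by rewrite (preserving_integrable fr).2 (preserving_integrable fi).2.
Qed.

End Preserving.

Section Coordinates.

Lemma measurable_coord (I : Type) d (T : measurableType d) (i : I) :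
  measurable_fun setT (fun f : power I T => f i).
Proof.
move=> _ A mA; rewrite setTI; apply: sub_sigma_algebra.
by exists i => //; exists A => //; rewrite setTI.
Qed.

Lemma measurable_proj (x : idx) (p : D x) : measurable_fun setT (@Defs.proj x p).
Proof. exact: (@measurable_coord (D x) _ cantor p). Qed.

Variable R : realType.

Lemma normc_exprz (z : R[i]) (k : int) : normc z = 1 -> normc (z ^ k) = 1.
Proof.
move=> z1; case: k => n; first by rewrite -exprnP normcX z1 expr1n.
by rewrite NegzE -exprnN normcV normcX z1 expr1n invr1.
Qed.

Lemma invc_unit (z : R[i]) : normc z = 1 -> z^-1 = z^*.
Proof.
move=> z1; have z0 : z != 0.
  by apply/eqP => z0; move: z1; rewrite z0 normc0 => /eqP; rewrite eq_sym oner_eq0.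
by apply: (mulfI z0); rewrite mulfV // mulcJ z1 expr1n.
Qed.

Lemma measurable_exprz d (T : measurableType d) (f : T -> R[i]) (k : int) :
  measurable_fun setT f -> (forall t, normc (f t) = 1) ->
  measurable_fun setT (fun t => f t ^ k).
Proof.
move=> mf f1.
have mX n : measurable_fun setT (fun t => f t ^+ n).
  elim: n => [|n ih]; first exact: measurable_cst.
  by under eq_fun do rewrite exprS; exact: measurable_mulC.
case: k => n; first exact: mX.
under eq_fun => t do rewrite NegzE -exprnN invc_unit ?normcX ?f1 ?expr1n //.
exact/measurable_conjC/mX.
Qed.

Lemma normc_prod (I : Type) (s : seq I) (F : I -> R[i]) :
  (forall i, normc (F i) = 1) -> normc (\prod_(i <- s) F i) = 1.
Proof.
move=> F1; elim: s => [|i s ih]; first by rewrite big_nil normc1.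
by rewrite big_cons normcM F1 ih mulr1.
Qed.

(** The multiplier through which a representation [rho] acts. *)
Definition char_fun (x : idx) (phi : cantor -> R[i]) (a : C_ x) : R[i] :=
  \prod_(p : D x) (phi (Defs.proj p a)) ^ ((val p).1).

Lemma normc_char_fun x phi a : L0T phi -> normc (@char_fun x phi a) = 1.
Proof.
by move=> [_ p1]; apply: normc_prod => p; exact: normc_exprz.
Qed.

Lemma measurable_char_fun x phi : L0T phi ->
  measurable_fun setT (@char_fun x phi).
Proof.
move=> [mp p1]; apply: measurable_prodC => p; apply: measurable_exprz => //.
exact: (measurableT_comp mp (measurable_proj p)).
Qed.

Lemma L2_char_fun x (m : {measure set (C_ x) -> \bar R}) phi f : L0T phi ->
  L2 m f -> L2 m (fun a => char_fun phi a * f a).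
Proof.
move=> Lp fL; apply: (L2_dominated (C := 1) fL).
  apply: measurable_mulC; first exact: measurable_char_fun.
  by case: fL.
by move=> a; rewrite normcM normc_char_fun // !mul1r.
Qed.

End Coordinates.

(** * The spectral isomorphism up to null sets *)

Section AlmostEverywhere.
Context (R : realType) d (T : measurableType d).
Variable mu : {measure set T -> \bar R}.
Implicit Types f g h : T -> R[i].

Lemma cintegral_ae f g : measurable_fun setT f -> measurable_fun setT g ->
  (\forall t \ae mu, f t = g t) -> cintegral mu f = cintegral mu g.
Proof.
move=> /measurable_ReIm[fr fi] /measurable_ReIm[gr gi] fg; rewrite /cintegral.
congr (_ +i* _); congr fine; apply: ae_eq_integral => //;
  try (by apply/measurable_EFinP);
  by apply: filterS fg => t -> _.
Qed.

Lemma L2ip_ae f g h : L2 mu f -> L2 mu g -> L2 mu h ->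
  (\forall t \ae mu, g t = h t) -> L2ip mu f g = L2ip mu f h.
Proof.
move=> [mf _] [mg _] [mh _] gh.
apply: cintegral_ae;
  try (by apply: measurable_mulC => //; exact: measurable_conjC).
by apply: filterS gh => t ->.
Qed.

End AlmostEverywhere.

Section SpectralMap.
Variables (R : realType) (lam : probability cantor R)
  (gam : probability (Xinf R) R)
  (alpha : (cantor -> R[i]) -> Xinf R -> Xinf R)
  (mu : forall x : idx, nat -> {finite_measure set (C_ x) -> \bar R}).

Definition nonfixed : set (Xinf R -> R[i]) :=
  @hilb R (nonfixed_part (koopman gam alpha)).

Definition koop (phi : cantor -> R[i]) (v : Xinf R -> R[i]) : Xinf R -> R[i] :=
  fun f => v (alpha (fun a => (phi a)^-1) f).

(** The given isomorphism, with the equality of vectors read as equality almost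
    everywhere. Representatives are not canonical, so [U] is linear and
    equivariant only up to null sets. *)
Record spectral_map (U : (Xinf R -> R[i]) -> forall i : idx * nat, C_ i.1 -> R[i])
    : Prop := SpectralMap {
  sm_L2 : forall v, nonfixed v -> forall i, L2 (mu i.1 i.2) (U v i);
  sm_lin : forall a v w, nonfixed v -> nonfixed w -> forall i,
    \forall t \ae mu i.1 i.2,
      U (fun f => a * v f + w f) i t = a * U v i t + U w i t;
  sm_norm : forall v, nonfixed v ->
    (\esum_(i in [set: idx * nat])
       (Rintegral (mu i.1 i.2) setT (fun t => normc (U v i t) ^+ 2))%:E =
     (Rintegral gam setT (fun f => normc (v f) ^+ 2))%:E)%E;
  sm_surj : forall w : forall i : idx * nat, C_ i.1 -> R[i],
    (forall i, @hilb R (rho (mu i.1 i.2)) (w i)) ->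
    (\esum_(i in [set: idx * nat])
       (Rintegral (mu i.1 i.2) setT (fun t => normc (w i t) ^+ 2))%:E < +oo)%E ->
    exists2 v, nonfixed v &
      forall i, \forall t \ae mu i.1 i.2, U v i t = w i t;
  sm_equiv : forall phi, L0T phi -> forall v, nonfixed v -> forall i,
    \forall t \ae mu i.1 i.2, U (koop phi v) i t = char_fun phi t * U v i t }.

Hypothesis act : boolean_action lam gam alpha.

Lemma nonfixed_L2 v : nonfixed v -> L2 gam v.
Proof. by case. Qed.

Lemma nonfixed_lin a v w : nonfixed v -> nonfixed w ->
  nonfixed (fun f => a * v f + w f).
Proof.
move=> [vL v0] [wL w0]; split; first exact: L2_lin.
move=> u uf; have uL : L2 gam u by case: uf.
have := L2ip_lin a vL wL uL => /= ->.
by rewrite (v0 u uf : L2ip gam v u = 0) (w0 u uf : L2ip gam w u = 0) mulr0 addr0.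
Qed.

Lemma nonfixed0 : nonfixed (fun=> 0).
Proof.
split; first exact: L2_0.
move=> w _; rewrite /= /L2ip /cintegral.
by under eq_Rintegral do rewrite mul0r;
  under [X in _ +i* X]eq_Rintegral do rewrite mul0r; rewrite /Rintegral integral0.
Qed.

Lemma nonfixed_scale a v : nonfixed v -> nonfixed (fun f => a * v f).
Proof.
move=> vN; have := nonfixed_lin a vN nonfixed0.
by under eq_fun do rewrite addr0.
Qed.

Lemma nonfixed_sum (I : Type) (s : seq I) (F : I -> Xinf R -> R[i]) :
  (forall i, nonfixed (F i)) -> nonfixed (fun f => \sum_(i <- s) F i f).
Proof.
move=> FN; elim: s => [|i s ih].
  by under eq_fun do rewrite big_nil; exact: nonfixed0.
under eq_fun do rewrite big_cons.
have := nonfixed_lin 1 (FN i) ih.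
by under eq_fun do rewrite mul1r.
Qed.

Lemma L0T_inv (phi : cantor -> R[i]) : L0T phi -> L0T (fun a => (phi a)^-1).
Proof.
move=> [mp p1]; split; last by move=> a; rewrite normcV p1 invr1.
have -> : (fun a => (phi a)^-1) = (fun a => (phi a)^*).
  by apply/funext => a; rewrite invc_unit.
exact: measurable_conjC.
Qed.

Lemma measurable_act phi : L0T phi -> measurable_fun setT (alpha phi).
Proof. exact: ba_measurable act phi. Qed.

Lemma preserving_act phi : L0T phi ->
  forall A, measurable A -> gam (alpha phi @^-1` A) = gam A.
Proof. exact: (ba_preserving act). Qed.

Lemma L2_koop phi v : L0T phi -> L2 gam v -> L2 gam (koop phi v).
Proof.
move=> Lp; apply: preserving_L2.
- exact/measurable_act/L0T_inv.
- exact/preserving_act/L0T_inv.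
Qed.

Lemma koop_ip phi v w : L0T phi -> L2 gam v -> L2 gam w ->
  L2ip gam (koop phi v) (koop phi w) = L2ip gam v w.
Proof.
move=> Lp vL wL; rewrite /L2ip.
have := @preserving_cintegral _ _ _ gam _ (measurable_act (L0T_inv Lp))
  (preserving_act (L0T_inv Lp)) (fun f => v f * (w f)^*).
by apply; exact: integrableC_mulJ.
Qed.

Lemma fixed_vectorsP w : @fixed_vectors R (koopman gam alpha) w ->
  L2 gam w /\ forall phi, L0T phi -> \forall f \ae gam, koop phi w f = w f.
Proof.
move=> [wL wf]; split=> // phi Lp.
apply/L2_aeP => //; first exact: L2_koop.
by rewrite -Re_L2ip; exact: wf.
Qed.

(** A fixed vector is not changed when a translation is applied to both sides of
    an inner product. *)
Lemma nonfixed_koop phi v : L0T phi -> nonfixed v -> nonfixed (koop phi v).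
Proof.
move=> Lp [vL v0]; split; first exact: L2_koop.
move=> w wf; have [wL wfix] := fixed_vectorsP wf.
rewrite -[RHS](v0 w wf) /= -(koop_ip Lp vL wL).
apply: L2ip_ae => //; try exact: L2_koop.
by apply: filterS (wfix _ Lp) => f ->.
Qed.

Lemma spectral_mapP :
  determines_spectral_form lam (koopman gam alpha) mu ->
  exists U, spectral_map U.
Proof.
move=> [_ _ [U [Uh Ul Un Us Ue]]]; exists U.
have UL v : nonfixed v -> forall i, L2 (mu i.1 i.2) (U v i).
  by move=> vN i; case: (Uh v vN i).
have N (i : idx * nat) (w : C_ i.1 -> R[i]) : Rintegral (mu i.1 i.2) setT (fun t => normc (w t) ^+ 2) =
    @sqnorm R (rho (mu i.1 i.2)) w by rewrite -Re_L2ip.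
split=> //.
- move=> a v w vN wN i; apply/L2_aeP.
  + by apply: UL; exact: nonfixed_lin.
  + by apply: L2_lin; exact: UL.
  + by rewrite -Re_L2ip; exact: (Ul a v w vN wN i).
- move=> v vN; rewrite -Re_L2ip -(Un v vN).
  by apply: eq_esum => i _; rewrite N.
- move=> w wh ws; have [|v vN vw] := Us w wh.
    by move: ws; under eq_esum do rewrite N.
  exists v => // i; apply/L2_aeP; first exact: UL.
    by case: (wh i).
  by rewrite -Re_L2ip; exact: vw.
- move=> phi Lp v vN i; apply/L2_aeP.
  + by apply: UL; exact: nonfixed_koop.
  + by apply: L2_char_fun => //; exact: UL.
  + by rewrite -Re_L2ip; exact: (Ue phi Lp v vN i).
Qed.

Variable U : (Xinf R -> R[i]) -> forall i : idx * nat, C_ i.1 -> R[i].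
Arguments U : clear implicits.
Hypothesis sm : spectral_map U.

Lemma sm_norm0 v : nonfixed v -> (\forall f \ae gam, v f = 0) ->
  forall i, \forall t \ae mu i.1 i.2, U v i t = 0.
Proof.
move=> vN v0 i.
have z : Rintegral gam setT (fun f => normc (v f) ^+ 2) = 0.
  have /L2_aeP := v0 => /(_ (nonfixed_L2 vN) (L2_0 _)) <-.
  by apply: eq_Rintegral => f _; rewrite subr0.
have := sm_norm sm vN; rewrite z => e0.
apply/L2_aeP; [exact: (sm_L2 sm)|exact: L2_0|].
under eq_Rintegral do rewrite subr0.
apply/eqP; rewrite eq_le; apply/andP; split; last first.
  by apply: Rintegral_ge0 => t _; exact: sqr_ge0.
rewrite -lee_fin -e0; apply: esum_ge; exists [set i].
  by split=> //; exact: finite_set1.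
by rewrite fsbig_set1.
Qed.

Lemma sm_ae v w : nonfixed v -> nonfixed w -> (\forall f \ae gam, v f = w f) ->
  forall i, \forall t \ae mu i.1 i.2, U v i t = U w i t.
Proof.
move=> vN wN vw i.
have d0 : \forall f \ae gam, -1 * w f + v f = 0.
  by apply: filterS vw => f ->; rewrite mulN1r addNr.
have := sm_norm0 (nonfixed_lin (-1) wN vN) d0 i.
have := sm_lin sm (-1) wN vN i.
apply: filterS2 => t -> /eqP; rewrite mulN1r addrC subr_eq0 => /eqP.
exact.
Qed.

Lemma sm_sum (I : Type) (s : seq I) (F : I -> Xinf R -> R[i]) :
  (forall j, nonfixed (F j)) -> forall i, \forall t \ae mu i.1 i.2,
    U (fun f => \sum_(j <- s) F j f) i t = \sum_(j <- s) U (F j) i t.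
Proof.
move=> FN i; elim: s => [|j s ih].
  have e : (fun f : Xinf R => \sum_(j <- [::]) F j f) = fun=> 0.
    by apply/funext => f; rewrite big_nil.
  rewrite e; apply: filterS (sm_norm0 nonfixed0 _ i).
    by move=> t ->; rewrite big_nil.
  by apply: aeW.
have e : (fun f : Xinf R => \sum_(k <- j :: s) F k f) =
         fun f => 1 * F j f + \sum_(k <- s) F k f.
  by apply/funext => f; rewrite big_cons mul1r.
rewrite e; apply: filterS2 ih (sm_lin sm 1 (FN j) (nonfixed_sum s FN) i).
by move=> t h ->; rewrite h big_cons mul1r.
Qed.

Lemma sm_inj v w : nonfixed v -> nonfixed w ->
  (forall i, \forall t \ae mu i.1 i.2, U v i t = U w i t) ->
  \forall f \ae gam, v f = w f.
Proof.
move=> vN wN vw; have dN := nonfixed_lin (-1) wN vN.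
suff d0 : \forall f \ae gam, -1 * w f + v f = 0.
  apply: filterS d0 => f /eqP; rewrite mulN1r addrC subr_eq0 => /eqP.
  exact.
apply/L2_aeP; [exact: nonfixed_L2|exact: L2_0|].
under eq_Rintegral do rewrite subr0.
suff: (Rintegral gam setT (fun f => normc (-1 * w f + v f) ^+ 2))%:E = 0%E by case.
rewrite -(sm_norm sm dN); apply: esum1 => i _; congr EFin.
have /L2_aeP : \forall t \ae mu i.1 i.2,
    U (fun f => -1 * w f + v f) i t = 0.
  have := sm_lin sm (-1) wN vN i; have := vw i.
  by apply: filterS2 => t -> ->; rewrite mulN1r addNr.
move=> <-; last exact: L2_0.
- by apply: eq_Rintegral => t _; rewrite subr0.
- exact: (sm_L2 sm).
Qed.

End SpectralMap.

(** * Points of the unit circle of large order *)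

Section UnitCircle.
Variable R : realType.

Lemma circle_point (t : R) :
  let c := ((1 - t ^+ 2) / (1 + t ^+ 2)) +i* (2 * t / (1 + t ^+ 2)) in
  normc c = 1.
Proof.
have t0 : 1 + t ^+ 2 != 0 by rewrite gt_eqF // ltr_wpDr ?sqr_ge0.
rewrite /= -[RHS]sqrtr1; congr Num.sqrt; field.
by [].
Qed.

(** Roots of unity of bounded order are the roots of one polynomial, while the
    circle is infinite. *)
Lemma circle_nonroot (B : nat) : exists2 c : R[i], normc c = 1 &
  forall j, (0 < j <= B)%N -> c ^+ j != 1.
Proof.
pose P : {poly R[i]} := \prod_(j < B) ('X^(j.+1) - 1).
have P0 : P != 0.
  apply/prodf_neq0 => j _; apply/eqP => /(congr1 (fun q : {poly _} => q`_j.+1)).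
  rewrite coefB coefXn eqxx coef1 coef0 /= subr0 => /eqP.
  by rewrite oner_eq0.
pose pt (n : nat) : R[i] :=
  ((1 - n%:R ^+ 2) / (1 + n%:R ^+ 2)) +i* (2 * n%:R / (1 + n%:R ^+ 2)).
have pt1 n : normc (pt n) = 1 by exact: circle_point.
have pt_inj : injective pt.
  move=> m n [e1 e2].
  have d (k : nat) : 1 + k%:R ^+ 2 != 0 :> R by rewrite gt_eqF // ltr_wpDr ?sqr_ge0.
  have h (k : nat) : (1 - k%:R ^+ 2) / (1 + k%:R ^+ 2) = 2 / (1 + k%:R ^+ 2) - 1 :> R.
    by field; exact: d.
  move: e1; rewrite !h => /addIr e1.
  have e3 : m%:R * (2 / (1 + m%:R ^+ 2)) = n%:R * (2 / (1 + m%:R ^+ 2)) :> R.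
    by rewrite [in RHS]e1 !mulrA !(mulrC _ 2).
  apply/eqP; rewrite -(eqr_nat R); apply/eqP; apply: mulIf e3.
  by rewrite mulf_neq0 ?invr_eq0 ?pnatr_eq0 // d.
have /allPn[c /mapP[n _ ->] Pc] : ~~ all (root P) [seq pt n | n <- iota 0 (size P)].
  apply/negP => /max_poly_roots - /(_ P0); rewrite map_inj_uniq // iota_uniq.
  by move=> /(_ isT); rewrite size_map size_iota ltnn.
exists (pt n) => // -[//|j] /andP[_ jB]; apply: contra Pc => /eqP e.
rewrite /root horner_prod; apply/prodf_eq0; exists (Ordinal jB) => //=.
by rewrite hornerD hornerN hornerXn hornerC e subrr.
Qed.

Lemma unit_neq0 (c : R[i]) : normc c = 1 -> c != 0.
Proof.
move=> c1; apply/eqP => c0; move: c1; rewrite c0 normc0 => /eqP.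
by rewrite eq_sym oner_eq0.
Qed.

Lemma circle_nonrootz (B : nat) : exists2 c : R[i], normc c = 1 &
  forall j : int, (`|j| <= B)%N -> c ^ j = 1 -> j = 0.
Proof.
have [c c1 cB] := circle_nonroot B; exists c => // -[] [|j] jB //.
  by move=> /eqP; rewrite -exprnP (negbTE (cB j.+1 _)).
- move=> /eqP; rewrite NegzE -exprnN invr_eq1.
  by rewrite (negbTE (cB 1%N _)).
move=> /eqP; rewrite NegzE -exprnN invr_eq1.
by rewrite (negbTE (cB j.+2 _)).
Qed.

End UnitCircle.

(** * Dyadic step functions and their action *)

Section DyadicSums.
Variable R : realType.

Lemma sum_tuple_cons (V : nmodType) k (F : seq bool -> V) :
  \sum_(u : k.+1.-tuple bool) F u =
  \sum_(u : k.-tuple bool) F (false :: u) + \sum_(u : k.-tuple bool) F (true :: u).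
Proof.
rewrite (reindex (fun p : bool * k.-tuple bool => [tuple of p.1 :: p.2])) /=.
  rewrite -(pair_big xpredT xpredT (fun b (u : k.-tuple bool) => F (b :: u))) /=.
  by rewrite big_bool /= addrC.
exists (fun u : k.+1.-tuple bool => (thead u, [tuple of behead u])) => u _.
  by case: u => b u; congr pair; apply: val_inj.
by rewrite /= -tuple_eta.
Qed.

Lemma Xval_split (f : Xinf R) (s : seq bool) k :
  Xval f s = ((Num.sqrt 2)%:C ^+ k)^-1 * \sum_(u : k.-tuple bool) Xval f (s ++ u).
Proof.
elim: k s => [|k ih] s.
  rewrite expr0 invr1 mul1r (big_pred1 [tuple]) /= ?cats0 // => u.
  by rewrite [u]tuple0; apply/esym/eqP.
have fX : Xinf_set (Xval f) by apply: set_mem; exact: (valP f).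
rewrite (fX s) (ih (rcons s false)) (ih (rcons s true)).
rewrite (sum_tuple_cons k (fun u => Xval f (s ++ u))) -mulrDr exprSr invfM.
rewrite mulrAC.
congr (_ * _).
by congr (_ + _); apply: eq_bigr => u _; rewrite cat_rcons.
Qed.

End DyadicSums.

Section StepFunctions.
Variable R : realType.

Definition pre (n : nat) (a : cantor) : seq bool := mkseq a n.

Definition cyl (t : seq bool) : set cantor := [set a | pre (size t) a = t].

Lemma cyl_nil : cyl [::] = setT.
Proof. by apply/seteqP; split. Qed.

Lemma pre_rcons n a : pre n.+1 a = rcons (pre n a) (a n).
Proof. by rewrite /pre /mkseq -addn1 iotaD map_cat /= cats1. Qed.

Lemma cyl_rcons t b : cyl (rcons t b) = cyl t `&` [set a | a (size t) = b].
Proof.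
apply/seteqP; split=> a; rewrite /cyl /= size_rcons pre_rcons.
  by move=> /rcons_inj[].
by move=> [-> ->].
Qed.

Lemma measurable_cyl t : measurable (cyl t).
Proof.
elim/last_ind: t => [|t b ih]; first by rewrite cyl_nil; exact: measurableT.
rewrite cyl_rcons; apply: measurableI => //.
have := @measurable_coord nat _ bool (size t) measurableT [set b] I.
by rewrite setTI.
Qed.

Definition stepf (t : seq bool) (c : R[i]) : cantor -> R[i] :=
  fun a => if pre (size t) a == t then c else 1.

Lemma stepf_inv t c : (fun a => (stepf t c a)^-1) = stepf t c^-1.
Proof. by apply/funext => a; rewrite /stepf; case: ifP => // _; rewrite invr1. Qed.

Lemma L0T_stepf t c : normc c = 1 -> L0T (stepf t c).
Proof.
move=> c1; split; last by move=> a; rewrite /stepf; case: ifP; rewrite ?normc1.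
apply: measurable_fun_ifT => //.
apply: (@measurable_fun_bool _ _ _ _ true); rewrite setTI.
suff -> : (fun a : cantor => pre (size t) a == t) @^-1` [set true] = cyl t.
  exact: measurable_cyl.
by apply/seteqP; split => a /eqP.
Qed.

Lemma SS_stepf t c : normc c = 1 -> SS (size t) (stepf t c).
Proof.
move=> c1; split; first exact: L0T_stepf.
move=> a b ab; rewrite /stepf (_ : pre _ a = pre (size t) b) //.
by apply/eq_in_map => i; rewrite mem_iota => /andP[_ /ab].
Qed.

Lemma gval_stepf t c s : size s = size t ->
  Defs.gval (stepf t c) s = if s == t then c else 1.
Proof.
move=> st; rewrite /Defs.gval /stepf (_ : pre _ _ = s) //.
by rewrite /pre -st; exact: mkseq_nth.
Qed.

Lemma dyadic_act_stepf (f : Xinf R) t c s : (size s <= size t)%N ->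
  dyadic_act (size t) (stepf t c) (Xval f) s =
  Xval f s + (if take (size s) t == s
    then (c - 1) * ((Num.sqrt 2)%:C ^+ (size t - size s))^-1 * Xval f t else 0).
Proof.
rewrite /dyadic_act leq_eqVlt => /orP[/eqP st|st].
  rewrite st leqnn gval_stepf // take_size eq_sym subnn expr0 invr1 mulr1.
  case: eqP => [->|_]; last by rewrite mul1r addr0.
  by rewrite mulrBl mul1r addrC subrK.
rewrite leqNgt st /= [in X in _ = X + _](Xval_split f s (size t - size s)).
set k := (size t - size s)%N; set r := (_ ^+ k)^-1.
have tk : size (drop (size s) t) == k by rewrite size_drop.
have g (u : k.-tuple bool) :
    Defs.gval (stepf t c) (s ++ u) * Xval f (s ++ u) = Xval f (s ++ u) +
    (if s ++ u == t then (c - 1) * Xval f t else 0).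
  rewrite gval_stepf; last by rewrite size_cat size_tuple subnKC // ltnW.
  case: eqP => [->|_]; last by rewrite mul1r addr0.
  by rewrite mulrBl mul1r addrC subrK.
under eq_bigr do rewrite g.
rewrite big_split mulrDr; congr (_ + _) => /=.
rewrite -big_mkcond /=; case: eqP => [e|ne].
  have eu (u : k.-tuple bool) : (s ++ u == t) = (u == Tuple tk).
    by rewrite -[X in _ == X](cat_take_drop (size s) t) e eqseq_cat // eqxx.
  rewrite (eq_bigl _ _ eu) big_pred1_eq.
  by rewrite [LHS]mulrA [_ * (c - 1)]mulrC.
rewrite big1 ?mulr0 // => u /eqP e; case: ne.
by rewrite -e take_size_cat.
Qed.

Variables (lam : probability cantor R) (gam : probability (Xinf R) R)
  (alpha : (cantor -> R[i]) -> Xinf R -> Xinf R).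
Hypothesis act : boolean_action lam gam alpha.

(** In the average that defines a coordinate above [t], the rotation changes one
    summand only. *)
Lemma act_stepf t c : normc c = 1 -> \forall f \ae gam, forall s,
  (size s <= size t)%N ->
  Xval (alpha (stepf t c) f) s =
  Xval f s + (if take (size s) t == s
    then (c - 1) * ((Num.sqrt 2)%:C ^+ (size t - size s))^-1 * Xval f t else 0).
Proof.
move=> c1; apply: filterS (ba_extends act (SS_stepf t c1)) => f h s st.
by rewrite h dyadic_act_stepf.
Qed.

End StepFunctions.

(** * Measures with densities *)

Section Density.
Context (R : realType) d (T : measurableType d).
Variable mu : {measure set T -> \bar R}.
Variable w : T -> R.
Hypothesis iw : mu.-integrable setT (EFin \o w).
Hypothesis w0 : forall t, 0 <= w t.

(** Integrability and positivity are arguments so that the structure of a finite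
    measure can be attached to the term. *)
Definition density of mu.-integrable setT (EFin \o w) & (forall t, 0 <= w t) :=
  fun A : set T => (\int[mu]_(t in A) (w t)%:E)%E.

Let nu := density iw w0.

Let density0 : nu set0 = 0%E.
Proof. by rewrite /nu /density integral_set0. Qed.

Let density_ge0 A : (0 <= nu A)%E.
Proof. by apply: integral_ge0 => t _; rewrite lee_fin. Qed.

Let density_sigma_additive : semi_sigma_additive nu.
Proof.
move=> /= A mA tA mUA; rewrite /nu /density integral_bigcup //=; last first.
  exact: (integrableS _ _ (@subsetT _ _) iw).
apply: is_cvg_ereal_nneg_natsum_cond => n _ _.
by apply: integral_ge0 => t _; rewrite lee_fin.
Qed.

HB.instance Definition _ := isMeasure.Build _ _ _ nu
  density0 density_ge0 density_sigma_additive.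

Let density_fin : fin_num_fun nu.
Proof.
move=> A mA; have iA := integrableS measurableT mA (@subsetT _ A) iw.
by rewrite /nu /density; exact: integrable_fin_num iA.
Qed.

HB.instance Definition _ := Measure_isFinite.Build _ _ _ nu density_fin.

End Density.

Section SigmaFiniteMeasure.
Context (R : realType) d (T : measurableType d) (m : {measure set T -> \bar R}).
Hypothesis sf : sigma_finite setT m.

(** A copy of [m] to which its sigma-finiteness can be attached. *)
Definition sf_measure of sigma_finite setT m : set T -> \bar R := m.

Let sfm := sf_measure sf.

HB.instance Definition _ := isMeasure.Build _ _ _ sfm
  (measure0 m) (measure_ge0 m) (@measure_semi_sigma_additive _ _ _ m).

HB.instance Definition _ := Measure_isSigmaFinite.Build _ _ _ sfm sf.

End SigmaFiniteMeasure.

Section DensityIntegral.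
Context (R : realType) d (T : measurableType d).
Variable m : {measure set T -> \bar R}.
Hypothesis sf : sigma_finite setT m.
Variable w : T -> R.
Hypothesis iw : m.-integrable setT (EFin \o w).
Hypothesis w0 : forall t, 0 <= w t.

Let mu := sf_measure sf.

Lemma density_dominates : density iw w0 `<< m.
Proof.
apply/null_content_dominatesP => A mA A0; rewrite /density.
apply: null_set_integral => //.
by apply: measurable_funTS; case/integrableP : iw.
Qed.

Lemma integral_density (h : T -> R) : measurable_fun setT h ->
  (forall t, 0 <= h t) ->
  (\int[density iw w0]_t (h t)%:E = \int[m]_t (h t * w t)%:E)%E.
Proof.
move=> mh h0; have dom := density_dominates.
have mw : measurable_fun setT (EFin \o w) by case/integrableP : iw.
have mrn := measurable_int _ (Radon_Nikodym_SigmaFinite.f_integrable (mu := mu) dom).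
have h0' t : (0 <= (EFin \o h) t)%E by rewrite lee_fin.
have mh' : measurable_fun setT (EFin \o h) by exact/measurable_EFinP.
have <- := Radon_Nikodym_SigmaFinite.change_of_variables (mu := mu) dom h0' measurableT mh'.
apply: ae_eq_integral => //.
- by apply: emeasurable_funM => //; exact/measurable_EFinP.
- under eq_fun do rewrite EFinM.
  by apply: emeasurable_funM => //; exact/measurable_EFinP.
- have : ae_eq mu setT (Radon_Nikodym_SigmaFinite.f (density iw w0) mu) (EFin \o w).
    apply: integral_ae_eq => //.
      exact: (Radon_Nikodym_SigmaFinite.f_integrable (mu := mu) dom).
    by move=> E _ mE; rewrite -(Radon_Nikodym_SigmaFinite.f_integral (mu := mu) dom).
  by apply: filterS => t h1 /h1 /= ->; rewrite EFinM.
Qed.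

End DensityIntegral.

Lemma sigma_finite_prod (R : realType) d1 d2 (T1 : measurableType d1)
  (T2 : measurableType d2) (m1 : {sigma_finite_measure set T1 -> \bar R})
  (m2 : {sigma_finite_measure set T2 -> \bar R}) :
  sigma_finite setT (m1 \x m2)%E.
Proof.
have [F FT Ffin] := sigma_finiteT m1; have [G GT Gfin] := sigma_finiteT m2.
(* Enumerates the pairs; the default value only repeats a rectangle. *)
pose e (n : nat) : nat * nat := odflt (0, 0)%N (@choice.unpickle (nat * nat)%type n).
exists (fun n => F (e n).1 `*` G (e n).2).
  apply/esym/seteqP; split=> // -[x y] _.
  have [i _ Fi] : (\bigcup_i F i) x by rewrite -FT.
  have [j _ Gj] : (\bigcup_i G i) y by rewrite -GT.
  by exists (@choice.pickle (nat * nat)%type (i, j)) => //; rewrite /e choice.pickleK.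
move=> n; have [mF fF] := Ffin (e n).1; have [mG fG] := Gfin (e n).2.
split; first exact: measurableX.
by rewrite product_measure1E // lte_mul_pinfty // ge0_fin_numE.
Qed.

(** * Moments of the Gaussian coordinates *)

Section GaussianMoments.
Variable R : realType.
Local Notation leb := (@lebesgue_measure R).
Local Notation leb2 := (leb \x leb)%E.

Definition gauss_dens (p : R * R) : R := pi^-1 * expR (- p.1 ^+ 2 - p.2 ^+ 2).

Lemma gauss_dens_ge0 p : 0 <= gauss_dens p.
Proof. by rewrite mulr_ge0 ?expR_ge0 // invr_ge0 pi_ge0. Qed.

Lemma measurable_gauss_dens : measurable_fun setT gauss_dens.
Proof.
apply: measurable_funM => //; apply: measurableT_comp => //.
by apply: measurable_funB; [apply: measurableT_comp => //|];
  apply: measurable_funX; [exact: measurable_fst|exact: measurable_snd].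
Qed.

Let N2 (p : R * R) : R := normal_pdf 0 1 p.1 * normal_pdf 0 1 p.2.

Let N2_ge0 p : 0 <= N2 p.
Proof. by rewrite mulr_ge0 // normal_pdf_ge0. Qed.

Let measurable_N2 : measurable_fun setT N2.
Proof.
apply: measurable_funM.
  exact: measurableT_comp (measurable_normal_pdf 0 1) measurable_fst.
exact: measurableT_comp (measurable_normal_pdf 0 1) measurable_snd.
Qed.

Let integrable_N2 : leb2.-integrable setT (EFin \o N2).
Proof.
apply/integrableP; split; first exact/measurable_EFinP.
under eq_integral do rewrite /= ger0_norm //.
rewrite fubini_tonelli1 /=; last 2 first.
- by apply/measurable_EFinP.
- by move=> p; rewrite /= lee_fin.
have E x : (\int[leb]_y (N2 (x, y))%:E = (normal_pdf 0 1 x)%:E)%E.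
  rewrite /N2 /=; under eq_integral do rewrite EFinM.
  rewrite ge0_integralZl //.
  - by rewrite integral_normal_pdf mule1.
  - by apply/measurable_EFinP; exact: measurable_normal_pdf.
  - by move=> y _; rewrite lee_fin normal_pdf_ge0.
  - by rewrite lee_fin normal_pdf_ge0.
rewrite /fubini_F /=; under eq_integral do rewrite E.
by rewrite integral_normal_pdf ltry.
Qed.

Let dens_bound : exists C, forall p : R * R,
  (p.1 ^+ 2 + p.2 ^+ 2) ^+ 2 * gauss_dens p <= C * N2 p /\ gauss_dens p <= C * N2 p.
Proof.
pose q := @normal_peak R 1; have q0 : 0 < q by exact: normal_peak_gt0 (oner_neq0 _).
have pi0 : 0 < (pi : R)^-1 by rewrite invr_gt0 pi_gt0.
(* With [u] the squared norm, [u ^ 2 exp (- u) <= 16 exp (- u / 2)]. *)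
exists (16 * pi^-1 / q ^+ 2) => -[a b] /=.
pose u := a ^+ 2 + b ^+ 2.
have u0 : 0 <= u by rewrite addr_ge0 ?sqr_ge0.
have NE : N2 (a, b) = q ^+ 2 * expR (- (u / 2)).
  rewrite /N2 /= /normal_pdf oner_eq0 /normal_fun !subr0 expr1n.
  rewrite mulrACA -expRD -/q -expr2; congr (_ * expR _).
  by rewrite /u; field.
have gE : gauss_dens (a, b) = pi^-1 * expR (- u).
  by rewrite /gauss_dens /= /u opprD.
rewrite NE gE -/u.
have -> : 16 * pi^-1 / q ^+ 2 * (q ^+ 2 * expR (- (u / 2))) =
   pi^-1 * (16 * expR (- (u / 2))).
  have q0' : q != 0 by rewrite gt_eqF.
  have pi0' : (pi : R) != 0 by rewrite gt_eqF // pi_gt0.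
  have G (P y : R) : P != 0 -> 16 * P^-1 / q ^+ 2 * (q ^+ 2 * y) = P^-1 * (16 * y).
    by move=> P0; field; rewrite P0 q0'.
  exact: G.
have e1 : expR (- u) = expR (- (u / 2)) * expR (- (u / 2)).
  by rewrite -expRD; congr expR; field.
have e2 : expR (- (u / 2)) * expR (u / 2) = 1 by rewrite -expRD addNr expR0.
have e3 : expR (u / 2) = expR (u / 4) ^+ 2.
  by rewrite expr2 -expRD; congr expR; field.
have e4 : 1 + u / 4 <= expR (u / 4) by exact: expR_ge1Dx.
have e5 : 0 < expR (- (u / 2)) by exact: expR_gt0.
have e6 : u ^+ 2 <= 16 * expR (u / 2) by rewrite e3; nra.
have e7 : 1 <= expR (u / 2) by rewrite e3; nra.
rewrite mulrCA !ler_pM2l // e1.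
move: e2 e5 e6 e7; move: (expR (- (u / 2))) (expR (u / 2)) => x y e2 e5 e6 e7.
have xy : u ^+ 2 * (x * x) = (u ^+ 2 * x) * x by rewrite mulrA.
have h1 : u ^+ 2 * x <= 16.
  have : u ^+ 2 * x <= 16 * y * x by rewrite ler_pM2r.
  by rewrite -mulrA (mulrC y) e2 mulr1.
have h2 : x <= 1.
  have : x * 1 <= x * y by rewrite ler_pM2l.
  by rewrite mulr1 e2.
split; first by rewrite xy ler_pM2r.
by rewrite ler_pM2r //; apply: (le_trans h2); rewrite ler1n.
Qed.

Lemma integrable_gauss_dens : leb2.-integrable setT (EFin \o gauss_dens).
Proof.
have [C hC] := dens_bound.
apply: (@le_integrableR _ _ _ leb2 gauss_dens (fun p => C * N2 p)).
- exact: measurable_gauss_dens.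
- by move=> p; rewrite ger0_norm ?gauss_dens_ge0 //; case: (hC p).
- exact: integrableRZ.
Qed.

Definition gauss2 := density integrable_gauss_dens gauss_dens_ge0.

Definition toC (p : R * R) : R[i] := p.1 +i* p.2.

Lemma measurable_toC : measurable_fun setT toC.
Proof.
apply/measurable_ReIm; split; first exact: measurable_fst.
exact: measurable_snd.
Qed.

Let measurable_toC' : measurable_fun
  [set: measurableTypeR R * measurableTypeR R] toC.
Proof. exact: measurable_toC. Qed.

Lemma gammaE (A : set R[i]) : gamma A = pushforward gauss2 toC A.
Proof. by []. Qed.

Lemma gauss2_moment4 : (\int[gauss2]_p (normc (toC p) ^+ 4)%:E < +oo)%E.
Proof.
have [C hC] := dens_bound.
have m4 : measurable_fun setT (fun p => normc (toC p) ^+ 4).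
  under eq_fun => p do rewrite (exprM _ 2 2).
  by apply: measurable_funX; apply: measurable_sqr_normc; exact: measurable_toC.
have h0 p : 0 <= normc (toC p) ^+ 4 by rewrite exprn_ge0 ?normc_ge0.
have E := integral_density (sigma_finite_prod leb leb) integrable_gauss_dens gauss_dens_ge0 m4 h0.
rewrite /gauss2 E.
have iC : leb2.-integrable setT (EFin \o (fun p => C * N2 p)) by exact: integrableRZ.
have [_] := integrableP _ _ _ iC.
apply: le_lt_trans; apply: ge0_le_integral => //.
- by move=> p _; rewrite lee_fin mulr_ge0 ?gauss_dens_ge0.
- apply/measurable_EFinP; apply: measurable_funM => //.
  exact: measurable_gauss_dens.
- by apply: measurableT_comp => //; case/integrableP : iC.
move=> p _; rewrite /= lee_fin; apply: le_trans (ler_norm _).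
have -> : normc (toC p) ^+ 4 = (p.1 ^+ 2 + p.2 ^+ 2) ^+ 2.
  by rewrite (exprM _ 2 2) sqr_normcE.
by case: (hC p).
Qed.

Lemma gauss2_0 : gauss2 [set p | toC p = 0] = 0%E.
Proof.
have -> : [set p | toC p = 0] = [set 0] `*` [set 0].
  by apply/seteqP; split=> -[a b] /=; [case=> -> ->|case=> -> ->].
apply: null_set_integral; first exact: measurableX.
  by apply: measurable_funTS; apply/measurable_EFinP; exact: measurable_gauss_dens.
have m0 : measurable [set (0 : R)] by exact: measurable_set1.
have E := @product_measure1E _ _ _ _ _ leb leb _ _ m0 m0.
have z : leb [set 0] = 0%E by exact: lebesgue_measure_set1.
by apply: (etrans E); apply: (etrans (congr2 (fun x y => (x * y)%E) z z)); rewrite mul0e.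
Qed.

Variable gam : probability (Xinf R) R.
Hypothesis gammaP : is_gamma_inf gam.

Lemma measurable_Xval (s : seq bool) :
  measurable_fun setT (fun f : Xinf R => Xval f s).
Proof.
have mX : measurable_fun setT (@Xval R : Xinf R -> power (seq bool) R[i]).
  by move=> _ B mB; rewrite setTI; exists B => //; rewrite setTI.
exact: measurableT_comp (@measurable_coord (seq bool) _ R[i] s) mX.
Qed.

Lemma law_Xval s (B : set R[i]) : measurable B ->
  gam [set f | B (Xval f s)] = gamma B.
Proof.
move=> mB; have := gammaP (k := size s) [fset (in_tuple s)]%fset (fun=> mB).
rewrite big_seq_fset1 => <-; congr (gam _).
apply/seteqP; split=> f /= h.
  by move=> i; rewrite inE => /eqP ->.
by apply: (h (in_tuple s)); rewrite inE.
Qed.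

Lemma integral_Xval s (h : R[i] -> R) : measurable_fun setT h ->
  (forall z, 0 <= h z) ->
  (\int[gam]_f (h (Xval f s))%:E = \int[gauss2]_p (h (toC p))%:E)%E.
Proof.
move=> mh h0.
have mh' : measurable_fun setT (EFin \o h) by exact/measurable_EFinP.
have pos y : y \in [set: R[i]] -> (0 <= (EFin \o h) y)%E by rewrite lee_fin.
have := ge0_integral_pushforward (measurable_Xval s) gam measurableT mh' pos.
rewrite preimage_setT => <-.
have := ge0_integral_pushforward measurable_toC' gauss2 measurableT mh' pos.
rewrite preimage_setT => <-.
apply: eq_measure_integral; first exact: measurable_Xval.
by move=> mX A mA _; exact: law_Xval.
Qed.

(** All coordinates, at every level, have the same law; its moments are taken in
    the plane. *)
Definition mom4 : R := Rintegral gauss2 setT (fun p => normc (toC p) ^+ 4).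
Definition mom2 : R := Rintegral gauss2 setT (fun p => normc (toC p) ^+ 2).

Lemma measurable_normcX (k : nat) :
  measurable_fun setT (fun z : R[i] => normc z ^+ k).
Proof.
have -> : (fun z : R[i] => normc z ^+ k) = fun z => Num.sqrt (normc z ^+ 2) ^+ k.
  by apply/funext => z; rewrite sqrtr_sqr ger0_norm ?normc_ge0.
apply: measurable_funX.
apply: measurableT_comp (measurable_sqr_normc (@measurable_id _ _ _)).
by apply: continuous_measurable_fun; exact: sqrt_continuous.
Qed.

Lemma integrable_Xval4 s :
  gam.-integrable setT (EFin \o (fun f => normc (Xval f s) ^+ 4)).
Proof.
apply/integrableP; split.
  apply/measurable_EFinP.
  exact: measurableT_comp (measurable_normcX 4) (measurable_Xval s).
under eq_integral do rewrite /= ger0_norm ?exprn_ge0 ?normc_ge0 //.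
rewrite (integral_Xval s (measurable_normcX 4)); first exact: gauss2_moment4.
by move=> z; rewrite exprn_ge0 ?normc_ge0.
Qed.

Lemma Rintegral_Xval4 s :
  Rintegral gam setT (fun f => normc (Xval f s) ^+ 4) = mom4.
Proof.
rewrite /mom4 /Rintegral (integral_Xval s (measurable_normcX 4)) //.
by move=> z; rewrite exprn_ge0 ?normc_ge0.
Qed.

Lemma L2_Xval s : L2 gam (fun f => Xval f s).
Proof.
apply: integrable_L2; first exact: measurable_Xval.
apply: (@le_integrableR _ _ _ gam _ (fun f => 1 + normc (Xval f s) ^+ 4)).
- apply: measurable_sqr_normc; exact: measurable_Xval.
- move=> f; rewrite ger0_norm ?sqr_ge0 // (exprM _ 2 2).
  have := sqr_ge0 (normc (Xval f s) ^+ 2 - 1); have := sqr_ge0 (normc (Xval f s)); nra.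
- apply: integrableRD; last exact: integrable_Xval4.
  exact: finite_measure_integrable_cst.
Qed.

Lemma Rintegral_Xval2 s :
  Rintegral gam setT (fun f => normc (Xval f s) ^+ 2) = mom2.
Proof.
rewrite /mom2 /Rintegral (integral_Xval s (measurable_normcX 2)) //.
by move=> z; rewrite exprn_ge0 ?normc_ge0.
Qed.

(** Otherwise a coordinate would vanish almost surely, but the origin is null for
    the Gaussian measure. *)
Lemma mom2_gt0 : 0 < mom2.
Proof.
rewrite lt_neqAle; apply/andP; split; last first.
  by apply: Rintegral_ge0 => p _; rewrite exprn_ge0 ?normc_ge0.
apply/eqP => e0.
have /L2_aeP ae : Rintegral gam setT (fun f => normc (Xval f [::] - 0) ^+ 2) = 0.
  rewrite -[RHS](esym e0) -(Rintegral_Xval2 [::]).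
  by apply: eq_Rintegral => f _; rewrite subr0.
have {ae}[N [mN N0 PN]] := ae (L2_Xval _) (L2_0 _).
pose Z := [set z : R[i] | z = 0].
have mZ : measurable Z.
  exists ([set 0] `*` [set 0]); first exact: measurableX.
  rewrite setTI; apply/seteqP; split=> -[a b] /=; first by case=> /= -> ->.
  by case=> -> ->.
have g0 := law_Xval [::] mZ.
have c1 : gam [set f | (~` Z) (Xval f [::])] = 0%E.
  apply: (subset_measure0 _ mN _ N0).
    have := measurable_Xval [::] measurableT (measurableC mZ).
    by rewrite setTI.
  by move=> f fZ; apply: PN => /=.
have := probability_setC gam (A := [set f | Z (Xval f [::])]).
have mA : measurable [set f : Xinf R | Z (Xval f [::])].
  by have := measurable_Xval [::] measurableT mZ; rewrite setTI.
move=> /(_ mA).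
rewrite (_ : ~` _ = [set f | (~` Z) (Xval f [::])]); last by [].
rewrite c1 g0 gammaE /pushforward (_ : toC @^-1` Z = [set p | toC p = 0]) //.
by rewrite gauss2_0 sube0 => /eqP; rewrite eq_sym onee_eq0.
Qed.

End GaussianMoments.

(** * The first chaos *)

Section FirstChaos.
Variables (R : realType) (lam : probability cantor R)
  (gam : probability (Xinf R) R)
  (alpha : (cantor -> R[i]) -> Xinf R -> Xinf R).
Hypothesis act : boolean_action lam gam alpha.
Hypothesis gammaP : is_gamma_inf gam.

Definition sc (n : nat) : R[i] := ((Num.sqrt 2)%:C ^+ n)^-1.

Lemma scJ n : (sc n)^* = sc n.
Proof.
rewrite /sc fmorphV rmorphXn; congr ((_ ^+ _)^-1).
by apply/eqP; rewrite eq_complex /= oppr0 !eqxx.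
Qed.

Lemma scD m n : sc (m + n) = sc m * sc n.
Proof. by rewrite /sc exprD invfM. Qed.

Lemma normc_sc n : normc (sc n) ^+ 2 = (2 ^+ n)^-1.
Proof.
rewrite /sc normcV normcX exprVn; congr (_^-1).
rewrite -exprM mulnC exprM; congr (_ ^+ n).
by rewrite sqr_normcE /= sqr_sqrtr // expr0n /= addr0.
Qed.

(** The part over the cylinder of [s] of the coordinate at the empty sequence
    ([k = -1]) or of its conjugate ([k = 1]). *)
Definition chaos1 (k : int) (s : seq bool) (f : Xinf R) : R[i] :=
  sc (size s) * (if k == -1 then Xval f s else (Xval f s)^*).

Lemma chaos1_split k s n f :
  chaos1 k s f = \sum_(u : n.-tuple bool) chaos1 k (s ++ u) f.
Proof.
rewrite /chaos1 (eq_bigr (fun u : n.-tuple bool => (sc (size s) * sc n) *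
    (if k == -1 then Xval f (s ++ u) else (Xval f (s ++ u))^*))); last first.
  by move=> u _; rewrite size_cat size_tuple scD.
have XE : Xval f s = sc n * \sum_(u : n.-tuple bool) Xval f (s ++ u).
  exact: Xval_split.
rewrite -mulr_sumr -mulrA XE; congr (_ * _).
case: ifP => _ //.
by rewrite rmorphM /= scJ rmorph_sum.
Qed.

Lemma chaos1_L2 k s : L2 gam (chaos1 k s).
Proof.
apply: L2Z; case: (k == -1); first exact: L2_Xval.
apply: (L2_dominated (C := 1) (L2_Xval gammaP s)).
  by apply: measurable_conjC; exact: measurable_Xval.
by move=> f; have -> := normc_conj (Xval f s); rewrite mul1r.
Qed.

Lemma chaos1_norm k s :
  Rintegral gam setT (fun f => normc (chaos1 k s f) ^+ 2) =
  (2 ^+ size s)^-1 * mom2 R.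
Proof.
rewrite -(Rintegral_Xval2 gammaP s) -RintegralZl //; last first.
  exact: L2_integrable (L2_Xval gammaP s).
apply: eq_Rintegral => f _; rewrite /chaos1 normcM exprMn normc_sc.
by case: ifP => _ //; have -> := normc_conj (Xval f s).
Qed.

Lemma koop_chaos1 (k : int) s t c : k = -1 \/ k = 1 -> normc c = 1 ->
  size t = size s -> \forall f \ae gam,
  koop alpha (stepf t c) (chaos1 k s) f = (if s == t then c ^ k else 1) * chaos1 k s f.
Proof.
move=> k1 c1 ts; have c1' : normc c^-1 = 1 by rewrite normcV c1 invr1.
apply: filterS (act_stepf act t c1') => f /(_ s); rewrite ts leqnn => /(_ isT).
rewrite -ts take_size subnn expr0 invr1 mulr1 => h.
have {}h : Xval (alpha (stepf t c^-1) f) s = (if s == t then c^-1 else 1) * Xval f s.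
  rewrite h eq_sym; case: eqP => [->|_]; last by rewrite addr0 mul1r.
  by rewrite mulrBl mul1r addrC subrK.
rewrite /koop stepf_inv /chaos1 h mulrCA; congr (_ * _).
case: k1 => ->; rewrite ?eqxx.
  by case: ifP => _; rewrite ?mul1r // -exprN1.
rewrite /= rmorphM expr1z; congr (_ * _); case: ifP => _; last by rewrite rmorph1.
by rewrite invc_unit //; exact: conjCK.
Qed.

(** The rotation by [-1] over the cylinder of [s] negates this vector and does not
    move the fixed vectors. *)
Lemma chaos1_nonfixed k s : k = -1 \/ k = 1 -> nonfixed gam alpha (chaos1 k s).
Proof.
move=> k1; split; first exact: chaos1_L2.
move=> w /(fixed_vectorsP act) [wL wfix].
have N1 : normc (-1 : R[i]) = 1 by rewrite normcN normc1.
have Lp := L0T_stepf s N1.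
have fL := chaos1_L2 k s.
have kE := koop_ip act Lp fL wL.
have k1' : \forall f \ae gam, koop alpha (stepf s (-1)) (chaos1 k s) f =
    -1 * chaos1 k s f + 0.
  apply: filterS (koop_chaos1 k1 N1 (erefl (size s))) => f ->.
  rewrite eqxx addr0; congr (_ * _).
  by case: k1 => ->; rewrite ?expr1z // exprN1 invrN1.
have : L2ip gam (chaos1 k s) w = - L2ip gam (chaos1 k s) w.
  rewrite -{1}kE.
  rewrite (L2ip_ae (L2_koop act Lp fL) (L2_koop act Lp wL) wL (wfix _ Lp)).
  have mw : measurable_fun setT (fun f => (w f)^*) by apply: measurable_conjC; case: wL.
  have mk : measurable_fun setT (koop alpha (stepf s (-1)) (chaos1 k s)).
    by case: (L2_koop act Lp fL).
  have mf : measurable_fun setT (fun f => -1 * chaos1 k s f + 0).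
    by case: (L2_lin (-1) fL (L2_0 gam)).
  transitivity (L2ip gam (fun f => -1 * chaos1 k s f + 0) w).
    apply: cintegral_ae; try exact: measurable_mulC.
    by apply: filterS k1' => f ->.
  rewrite (L2ip_lin (-1) fL (L2_0 gam) wL) mulN1r.
  rewrite [X in _ + X](_ : _ = 0) ?addr0 //.
  rewrite /L2ip /cintegral.
  by under eq_Rintegral do rewrite mul0r;
    under [X in _ +i* X]eq_Rintegral do rewrite mul0r; rewrite /Rintegral integral0.
move=> /eqP; rewrite -addr_eq0 -mulr2n mulrn_eq0 /= => /eqP.
exact.
Qed.

End FirstChaos.

(** * Indices with a single entry *)

Section SingleIndex.

(** The index written [k x10] when [k] is not zero. *)
Definition single (x : idx) (k : int) : Prop :=
  forall n : int, val x n = (n == k) :> nat.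

Lemma singleP (x : idx) (k : int) :
  (forall p : D x, (val p).1 = k) -> (forall p q : D x, p = q) -> single x k.
Proof.
move=> xk xu n; have /andP[_ /fset0Pn[l lx]] := valP x.
have Dp (l' : int) (j : nat) : (j < val x l')%N -> (l', j) \in D x by rewrite in_D.
have Dk (l' : int) : (0 < val x l')%N -> l' = k.
  by move=> /Dp h; have := xk [` h]%fset.
have lx0 : (0 < val x l)%N by rewrite lt0n -mem_finsupp.
have lk := Dk _ lx0; rewrite lk in lx0.
case: eqP => [->|nk]; last first.
  by apply/eqP; rewrite -leqn0 leqNgt; apply/negP => /Dk.
apply/eqP; rewrite eqn_leq lx0 andbT leqNgt; apply/negP => x1.
have := xu [` Dp k 0%N lx0]%fset [` Dp k 1%N x1]%fset.
by move=> /(congr1 val).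
Qed.

Lemma single_inj x y k : single x k -> single y k -> x = y.
Proof.
move=> xk yk; apply: val_inj; apply/fsfunP => n.
by rewrite xk yk.
Qed.

Lemma single_D x k (p : D x) : single x k -> val p = (k, 0%N).
Proof.
move=> xk; have := valP p; rewrite in_D xk; case: (val p) => l j /=.
by case: eqP => [->|//]; case: j.
Qed.

Lemma single_pt x k : single x k -> (k, 0%N) \in D x.
Proof. by move=> xk; rewrite in_D xk eqxx. Qed.

Definition pt x k (xk : single x k) : D x := [` single_pt xk]%fset.

Lemma single_uniq x k (xk : single x k) (p : D x) : p = pt xk.
Proof. by apply: val_inj; rewrite (single_D p xk). Qed.

Lemma single_x10 : single x10 1.
Proof.
move=> n; rewrite /= /x10_fsfun fsfun_fun inE.
by case: eqP.
Qed.

Lemma single_zmul (m : Zx) : single (zmul m x10) (val m).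
Proof.
move=> n; have m0 := valP m.
case: eqP => [->|nm].
  have := zmulE m x10 1; rewrite mulr1 => ->.
  by rewrite single_x10.
apply/eqP/negPn/negP => h; have := zmul_fsfun_neq0 h => e.
have : val x10 (n %/ val m)%Z != 0%N.
  by rewrite -(zmulE m x10) -e.
rewrite single_x10; case: (eqVneq _ (1 : int)) => [e1 _|//].
apply: nm.
by rewrite e e1 mulr1.
Qed.

End SingleIndex.

Section Characters.
Variable R : realType.

Lemma char_fun_stepf x t (c : R[i]) (a : C_ x) : c != 0 ->
  char_fun (stepf t c) a = c ^ (\sum_(p : D x | pre (size t) (a p) == t) (val p).1).
Proof.
move=> c0; rewrite /char_fun (big_mkcond (fun p => _ == t)) /=.
have h (s : seq (D x)) : \prod_(p <- s) stepf t c (Defs.proj p a) ^ (val p).1 =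
   c ^ (\sum_(p <- s) if pre (size t) (a p) == t then (val p).1 else 0).
  elim: s => [|p s ih]; first by rewrite !big_nil expr0z.
  rewrite !big_cons ih expfzDr //; congr (_ * _).
  by rewrite /stepf /Defs.proj; case: ifP => _; rewrite ?exp1rz ?expr0z.
exact: h.
Qed.

(** Bounds the total weight over any set of cylinders, hence the orders of the
    roots of unity to be avoided. *)
Definition weight_bound (x : idx) : nat := (\sum_(p : D x) absz (val p).1)%N.

Lemma weight_boundP x (P : pred (D x)) :
  (absz (\sum_(p : D x | P p) (val p).1)%R <= weight_bound x)%N.
Proof.
rewrite -lez_nat abszE; apply: le_trans (ler_norm_sum _ _ _) _.
rewrite /weight_bound (big_morph Posz PoszD (erefl _)) big_mkcond /=.
by apply: ler_sum => p _; case: ifP => _; rewrite ?abszE.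
Qed.

Lemma separating_prefix x (a : C_ x) (m : nat) :
  (forall p q : D x, p != q -> a p <> a q) ->
  exists n, forall p q : D x, p != q -> pre (m + n) (a p) != pre (m + n) (a q).
Proof.
move=> ad.
have /choice[f fP] (pq : D x * D x) : exists i : nat,
    pq.1 != pq.2 -> a pq.1 i != a pq.2 i.
  have [e|ne] := eqVneq pq.1 pq.2; first by exists 0%N.
  apply: contrapT => /forallNP h; apply: (ad _ _ ne); apply/funext => i.
  by apply/eqP/negPn/negP => hi; apply: (h i).
exists (\max_(pq : D x * D x) (f pq)).+1 => p q pq; apply/eqP => e.
have /negP := fP (p, q) pq; apply; apply/eqP.
have lt : (f (p, q) < m + (\max_(pq : D x * D x) f pq).+1)%N.
  by rewrite addnS ltnS (leq_trans (leq_bigmax (p, q))) // leq_addl.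
have := congr1 (fun s => nth false s (f (p, q))) e.
by rewrite !nth_mkseq.
Qed.

(** At a level that separates the coordinates of the point, a cylinder contains at
    most one of them. The weight of a coordinate is not zero, so every coordinate
    lies over [s ++ u] and has weight [k]. *)
Lemma concentrated_single x (a : C_ x) (k : int) (s : seq bool) : k != 0 ->
  (forall p q : D x, p != q -> a p <> a q) ->
  (forall n, exists2 u : n.-tuple bool, True &
     forall t : (size s + n).-tuple bool,
     \sum_(p : D x | pre (size s + n) (a p) == t) (val p).1 =
       if s ++ u == t then k else 0) ->
  single x k /\ forall p : D x, pre (size s) (a p) = s.
Proof.
move=> k0 ad H; have [n sep] := separating_prefix (size s) ad.
have [u _ Hu] := H n.
have key p : (val p).1 = k /\ pre (size s + n) (a p) = s ++ u.
  have st : size (pre (size s + n) (a p)) == (size s + n)%N by rewrite size_mkseq.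
  have := Hu (Tuple st); rewrite /= (big_pred1 p); last first.
    move=> q /=; case: (eqVneq q p) => [->|/sep/negbTE //]; exact: eqxx.
  case: eqP => [-> ->//|_ p0].
  have x0 : val x 0 = 0%N by have /andP[/eqP] := valP x.
  by have := valP p; rewrite in_D p0 x0.
split.
  apply: singleP => [p|p q]; first by case: (key p).
  by apply/eqP/negPn/negP => /sep; rewrite (key p).2 (key q).2 eqxx.
move=> p; have [_ e] := key p.
rewrite -[RHS](take_size_cat u (erefl (size s))) -e.
by rewrite /pre /mkseq -map_take take_iota (minn_idPl (leq_addr _ _)).
Qed.

End Characters.

(** * Supports of the components of the first chaos *)

Section Concentration.
Variables (R : realType) (lam : probability cantor R)
  (gam : probability (Xinf R) R)
  (alpha : (cantor -> R[i]) -> Xinf R -> Xinf R)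
  (mu : forall x : idx, nat -> {finite_measure set (C_ x) -> \bar R}).
Hypothesis act : boolean_action lam gam alpha.
Hypothesis gammaP : is_gamma_inf gam.
Hypothesis mu_compat : forall x j, compatible lam (mu x j).
Variable U : (Xinf R -> R[i]) -> forall i : idx * nat, C_ i.1 -> R[i].
Arguments U : clear implicits.
Hypothesis sm : spectral_map gam alpha mu U.

Lemma sm_scale a v : nonfixed gam alpha v -> forall i,
  \forall t \ae mu i.1 i.2, U (fun f => a * v f) i t = a * U v i t.
Proof.
move=> vN i; have N0 := @nonfixed0 R gam alpha.
have e : (fun f : Xinf R => a * v f) = fun f => a * v f + 0.
  by apply/funext => f; rewrite addr0.
have z : \forall f \ae gam, (fun=> 0 : R[i]) f = 0 by exact: aeW.
rewrite e; apply: filterS2 (sm_lin sm a vN N0 i) (sm_norm0 sm N0 z i).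
by move=> t -> ->; rewrite addr0.
Qed.

Lemma distinct_ae x j : \forall a \ae mu x j,
  forall p q : D x, p != q -> a p <> a q.
Proof.
apply: filter_forall => p; apply: filter_forall => q.
have [_|pq] := eqVneq p q; first exact: aeW.
have [_ _ /(_ p q pq) [N [mN N0 sN]]] := mu_compat x j.
exists N; split=> // a /= h; apply: sN => /=.
by apply: contrapT => h'; apply: h.
Qed.

Variable k : int.
Hypothesis k1 : k = -1 \/ k = 1.

Lemma U_chaos1_split s i n : \forall a \ae mu i.1 i.2,
  U (chaos1 k s) i a = \sum_(u : n.-tuple bool) U (chaos1 k (s ++ u)) i a.
Proof.
have e : chaos1 k s = fun f : Xinf R => \sum_(u : n.-tuple bool) chaos1 k (s ++ u) f.
  by apply/funext => f; exact: chaos1_split.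
have FN (u : n.-tuple bool) : nonfixed gam alpha (chaos1 k (s ++ u)).
  exact: (chaos1_nonfixed act gammaP).
by rewrite [in X in \forall a \ae _, X a]e; exact: (sm_sum sm _ FN).
Qed.

Lemma U_chaos1_eigen s t i c : normc c = 1 -> size t = size s ->
  \forall a \ae mu i.1 i.2,
  char_fun (stepf t c) a * U (chaos1 k s) i a =
  (if s == t then c ^ k else 1) * U (chaos1 k s) i a.
Proof.
move=> c1 ts; have Lp := L0T_stepf t c1.
have FN := chaos1_nonfixed act gammaP s k1.
set z := if s == t then _ else _.
have kN := nonfixed_koop act Lp FN.
have zN := nonfixed_scale z FN.
have := sm_ae sm kN zN (koop_chaos1 act k1 c1 ts) i.
apply: filterS3 (sm_equiv sm Lp FN i) (sm_scale z FN i).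
by move=> a h1 h2 h3; rewrite -h1 -h2.
Qed.

(** Rotations over the cylinders of a level, by a point of the circle whose small
    powers are not 1, read off the total weight that the point has over each
    cylinder. *)
Lemma U_chaos1_supp s i : \forall a \ae mu i.1 i.2, U (chaos1 k s) i a != 0 ->
  single i.1 k /\ forall p : D i.1, pre (size s) (a p) = s.
Proof.
have [c c1 cB] := circle_nonrootz R (weight_bound i.1 + 1).
have c0 := unit_neq0 c1.
have H : \forall a \ae mu i.1 i.2, forall n,
    U (chaos1 k s) i a = \sum_(u : n.-tuple bool) U (chaos1 k (s ++ u)) i a /\
    forall (u : n.-tuple bool) (t : (size s + n).-tuple bool),
     char_fun (stepf t c) a * U (chaos1 k (s ++ u)) i a =
     (if s ++ u == t then c ^ k else 1) * U (chaos1 k (s ++ u)) i a.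
  apply: ae_foralln => n.
  have h : \forall a \ae mu i.1 i.2, forall (u : n.-tuple bool)
      (t : (size s + n).-tuple bool),
      char_fun (stepf t c) a * U (chaos1 k (s ++ u)) i a =
      (if s ++ u == t then c ^ k else 1) * U (chaos1 k (s ++ u)) i a.
    apply: filter_forall => u; apply: filter_forall => t.
    by apply: U_chaos1_eigen => //; rewrite size_cat !size_tuple.
  by apply: filterS2 (U_chaos1_split s i n) h => a h1 h2; split.
apply: filterS2 H (distinct_ae i.1 i.2) => a Ha ad Ua0.
have k0 : k != 0 by case: k1 => ->.
apply: (@concentrated_single i.1 a k s k0 ad) => n; have [Us Ue] := Ha n.
have /existsP[u Uu0] : [exists u : n.-tuple bool, U (chaos1 k (s ++ u)) i a != 0].
  apply: contraR Ua0 => /existsPn h; rewrite Us big1 // => u _.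
  by apply/eqP/negPn; exact: h.
exists u => // t; have := Ue u t; rewrite char_fun_stepf //.
rewrite size_tuple; set w := \sum_(p | _) _ => e.
have {}e : c ^ w = c ^ (if s ++ u == t then k else 0).
  move/(mulIf Uu0) : e => ->.
  by case: ifP => _; rewrite ?expr0z.
apply/eqP; rewrite -subr_eq0; apply/eqP; apply: cB.
  rewrite -lez_nat abszE; apply: le_trans (ler_normB _ _) _.
  rewrite PoszD; apply: lerD; first by rewrite -abszE lez_nat weight_boundP.
  by case: ifP => _ //; case: k1 => ->.
by rewrite expfzDr // e -expfzDr // subrr expr0z.
Qed.

End Concentration.

(** * Measures determined on cylinders *)

Section CylinderMeasures.
Variable R : realType.

Definition cyl_system : set (set cantor) :=
  [set A | A = set0 \/ exists s, A = cyl s].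

Lemma cyl_prefix s t : prefix s t -> cyl s `&` cyl t = cyl t.
Proof.
move=> /prefixP[u ->]; apply/seteqP; split=> a; first by case.
rewrite /cyl /= size_cat => e; split=> //=.
rewrite -[RHS](take_size_cat u (erefl (size s))) -e.
by rewrite /pre /mkseq -map_take take_iota (minn_idPl (leq_addr _ _)).
Qed.

Lemma cyl_meet s t : cyl s `&` cyl t !=set0 -> (size s <= size t)%N -> prefix s t.
Proof.
move=> [a [/= sa ta]] st; rewrite prefixE -[in take _ t]ta -[X in _ == X]sa.
by rewrite /pre /mkseq -map_take take_iota (minn_idPl st).
Qed.

Lemma cyl_system_setI : setI_closed cyl_system.
Proof.
move=> A B [->|[s ->]]; first by rewrite set0I; left.
move=> [->|[t ->]]; first by rewrite setI0; left.
have [->|/set0P ne] := eqVneq (cyl s `&` cyl t) set0; first by left.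
have [st|/ltnW ts] := leqP (size s) (size t).
  by right; exists t; exact: cyl_prefix (cyl_meet ne st).
by right; exists s; rewrite setIC in ne *; exact: cyl_prefix (cyl_meet ne ts).
Qed.

Lemma cyl_system_gen : @measurable _ cantor = <<s cyl_system >>.
Proof.
apply/seteqP; split; apply: smallest_sub; try exact: smallest_sigma_algebra.
- move=> A [i _ [Y mY <-]]; rewrite setTI.
  have -> : (fun f : nat -> bool => f i) @^-1` Y =
      \big[setU/set0]_(u : i.+1.-tuple bool | `[< Y (nth false u i) >]) cyl u.
    apply/seteqP; split=> [a Ya|a].
      have st : size (pre i.+1 a) == i.+1 by rewrite size_mkseq.
      rewrite -bigcup_seq_cond /=; exists (Tuple st); rewrite /= ?mem_index_enum.
        by apply/asboolP; rewrite nth_mkseq.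
      by have := eqP st; rewrite /cyl /= => ->.
    rewrite -bigcup_seq_cond /= => -[u /= /andP[_ /asboolP Yu]].
    rewrite /cyl /= size_tuple => ua; rewrite /preimage /=.
    by rewrite -ua nth_mkseq in Yu.
  apply: (@bigsetU_measurable _ (g_sigma_algebraType cyl_system)) => u _.
  by apply: sub_sigma_algebra; right; exists u.
- by move=> A [->|[s ->]]; [exact: measurable0|exact: measurable_cyl].
Qed.

Lemma cyl_unique (m1 m2 : {measure set cantor -> \bar R}) :
  (forall s, m1 (cyl s) = m2 (cyl s)) -> (m1 setT < +oo)%E ->
  forall A, measurable A -> m1 A = m2 A.
Proof.
move=> h fin A mA.
apply: (measure_unique cyl_system (fun=> setT)) => //.
- exact: cyl_system_gen.
- exact: cyl_system_setI.
- by move=> _; right; exists [::]; rewrite cyl_nil.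
- by rewrite bigcup_const.
- by move=> B [->|[s ->]]; rewrite ?measure0.
Qed.

Lemma lambda_cyl (lam : probability cantor R) : is_lambda lam ->
  forall s, lam (cyl s) = ((2 ^+ size s)^-1)%:E.
Proof.
move=> hl s.
have := hl [fset i in iota 0 (size s)]%fset (fun i => [set nth false s i]).
move=> /(_ (fun=> I)).
have -> : [set f : power nat bool | forall i, i \in [fset i0 in iota 0 (size s)]%fset ->
    [set nth false s i] (f i)] = cyl s.
  apply/seteqP; split=> a /= h.
    apply: (@eq_from_nth _ false); first by rewrite size_mkseq.
    move=> i; rewrite size_mkseq => hi; rewrite nth_mkseq //.
    by apply: h; rewrite inE mem_iota.
  move=> i; rewrite inE mem_iota /= => hi.
  by rewrite -h nth_mkseq.
move=> ->.
have b2 (b : bool) : bernoulli_prob (2^-1 : R) [set b] = (2^-1)%:E.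
  rewrite bernoulli_probE; last by rewrite invr_ge0 ler0n invf_le1 ?ler1n ?ltr0n.
  rewrite !diracE; case: b.
    rewrite (@mem_set _ [set true] true) // (@memNset _ [set true] false) //.
    by rewrite mule1 mule0 adde0.
  rewrite (@mem_set _ [set false] false) // (@memNset _ [set false] true) //.
  rewrite mule1 mule0 add0e; congr EFin; have h : 1 - 2^-1 = 2^-1 :> R by lra.
  exact: h.
under eq_bigr do rewrite b2.
rewrite prodEFin big_const_seq count_predT card_fseq undup_id ?iota_uniq //.
by rewrite size_iota -exprVn; congr EFin; elim: (size s) => //= n ->; rewrite exprS.
Qed.

End CylinderMeasures.

(** * Domination of the product measure *)

Section FirstChaosMeasure.
Variables (R : realType) (lam : probability cantor R)
  (gam : probability (Xinf R) R)
  (alpha : (cantor -> R[i]) -> Xinf R -> Xinf R)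
  (mu : forall x : idx, nat -> {finite_measure set (C_ x) -> \bar R}).
Hypothesis lamP : is_lambda lam.
Hypothesis act : boolean_action lam gam alpha.
Hypothesis gammaP : is_gamma_inf gam.
Hypothesis mu_compat : forall x j, compatible lam (mu x j).
Hypothesis mu_dom : forall x j, mu x j.+1 `<< mu x j.
Variable U : (Xinf R -> R[i]) -> forall i : idx * nat, C_ i.1 -> R[i].
Arguments U : clear implicits.
Hypothesis sm : spectral_map gam alpha mu U.
Variables (k : int) (x : idx).
Hypothesis k1 : k = -1 \/ k = 1.
Hypothesis xk : single x k.

Let p0 := pt xk.
Let u : nat -> C_ x -> R[i] := fun j => U (chaos1 k [::]) (x, j).

Let uL j : L2 (mu x j) (u j).
Proof. exact: (sm_L2 sm (chaos1_nonfixed act gammaP [::] k1) (x, j)). Qed.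

Let UL s i : L2 (mu i.1 i.2) (U (chaos1 k s) i).
Proof. exact: (sm_L2 sm (chaos1_nonfixed act gammaP s k1) i). Qed.

(** The parts over the cylinders of one level have disjoint supports and add up to
    the whole component. *)
Lemma U_chaos1_restrict s j : \forall a \ae mu x j,
  U (chaos1 k s) (x, j) a = if pre (size s) (a p0) == s then u j a else 0.
Proof.
have h : \forall a \ae mu x j, forall v : (size s).-tuple bool,
    U (chaos1 k v) (x, j) a != 0 -> forall p : D x, pre (size v) (a p) = v.
  apply: filter_forall => v.
  apply: filterS (U_chaos1_supp act gammaP mu_compat sm k1 v (x, j)) => a H.
  by move=> /H[].
apply: filterS2 (U_chaos1_split act gammaP sm k1 [::] (x, j) (size s)) h.
move=> a ha H; case: eqP => [e|ne]; last first.
  apply/eqP/negPn/negP => h0; apply: ne.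
  exact: (H (in_tuple s) h0).
rewrite /u ha (bigD1 (in_tuple s)) //= big1 ?addr0 // => v vs.
apply/eqP/negPn/negP => /H /(_ p0); rewrite size_tuple e => sv.
by move: vs; rewrite -val_eqE /= -sv eqxx.
Qed.

Let w : nat -> C_ x -> R := fun j a => normc (u j a) ^+ 2.

Let w0 : forall j a, 0 <= w j a. Proof. by move=> j a; exact: sqr_ge0. Qed.

Let iw j := L2_integrable (uL j).

Let mproj : measurable_fun setT (@Defs.proj x p0).
Proof. exact: measurable_proj. Qed.

Let mpre A : measurable A -> measurable (@Defs.proj x p0 @^-1` A).
Proof. by move=> mA; have := mproj measurableT mA; rewrite setTI. Qed.

Let nus : nat -> {measure set cantor -> \bar R} := fun j =>
  measure_function_pushforward__canonical__measure_function_Measure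
    (density (iw j) (w0 j)) mproj.

Let nu := mseries nus 0.

Lemma component_norm_cyl s j :
  (Rintegral (mu x j) setT (fun a => normc (U (chaos1 k s) (x, j) a) ^+ 2))%:E =
  (\int[mu x j]_(a in @Defs.proj x p0 @^-1` cyl s) (w j a)%:E)%E.
Proof.
have sL : L2 (mu x j) (U (chaos1 k s) (x, j)) by exact: (UL s (x, j)).
rewrite /Rintegral fineK; last first.
  by apply: integrable_fin_num => //; exact: L2_integrable sL.
rewrite [RHS]integral_mkcond; apply: ae_eq_integral => //.
- by apply/measurable_EFinP; exact: measurable_sqr_normc sL.1.
- apply/(measurable_restrictT _ (mpre (measurable_cyl s))).
  apply: measurable_funTS; apply/measurable_EFinP.
  exact: measurable_sqr_normc (uL j).1.
apply: filterS (U_chaos1_restrict s j) => a -> _; rewrite patchE.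
case: eqP => [e|ne]; first by rewrite mem_set.
by rewrite memNset // normc0 expr0n.
Qed.

Lemma other_components s i : i.1 <> x ->
  Rintegral (mu i.1 i.2) setT (fun a => normc (U (chaos1 k s) i a) ^+ 2) = 0.
Proof.
move=> ix.
have /L2_aeP : \forall a \ae mu i.1 i.2, U (chaos1 k s) i a = 0.
  apply: filterS (U_chaos1_supp act gammaP mu_compat sm k1 s i) => a h.
  apply/eqP/negPn/negP => /h[ik _]; apply: ix.
  exact: single_inj ik xk.
move=> /(_ (UL s i) (L2_0 _)) <-.
by apply: eq_Rintegral => a _; rewrite subr0.
Qed.

(** The isometry applied to the part of the first chaos over the cylinder; its
    components over the other indices vanish. *)
Lemma nu_cyl s : nu (cyl s) = ((2 ^+ size s)^-1 * mom2 R)%:E.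
Proof.
rewrite -(chaos1_norm gammaP k s) -(sm_norm sm (chaos1_nonfixed act gammaP s k1)).
pose a (i : idx * nat) := (Rintegral (mu i.1 i.2) setT
   (fun t => normc (U (chaos1 k s) i t) ^+ 2))%:E.
have a0 i : (0 <= a i)%E by rewrite lee_fin; apply: Rintegral_ge0 => t _; exact: sqr_ge0.
have -> : (\esum_(i in [set: idx * nat]) a i = \esum_(i in [set i | i.1 = x]) a i)%E.
  rewrite [RHS]esum_mkcond; apply: eq_esum => i _.
  have [ix|ix] := pselect (i.1 = x); first by rewrite mem_set.
  by rewrite memNset // /a other_components.
have -> : [set i : idx * nat | i.1 = x] = [set (x, j) | j in [set: nat]].
  by apply/seteqP; split=> [[y j] /= <-|_ [j _ <-] //]; exists j.
rewrite (reindex_esum setT _ (fun j : nat => (x, j))) //; last first.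
  by split=> [j _|j j' _ _ [] //|_ [j _ <-]]; [exists j|exists j].
rewrite -nneseries_esumT; last by move=> j; exact: a0.
rewrite /nu /mseries; apply: eq_eseriesr => j _.
by rewrite /a component_norm_cyl.
Qed.

(** The densities of the components add up to a positive multiple of [lam], and
    each is taken with respect to a measure that vanishes on [A]. *)
Lemma lambda_dominated A : measurable A ->
  mu x 0%N (@Defs.proj x p0 @^-1` A) = 0%E -> lam A = 0%E.
Proof.
move=> mA A0; have m2 := mom2_gt0 gammaP.
have mP : measurable (@Defs.proj x p0 @^-1` A).
  exact: mpre.
have Aj j : mu x j (@Defs.proj x p0 @^-1` A) = 0%E.
  elim: j => // j ih.
  by have /null_content_dominatesP h := @mu_dom x j; exact: h _ mP ih.
have nA : nu A = 0%E.
  rewrite /nu /mseries; apply: eseries0 => j _ _.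
  have mw : measurable_fun (@Defs.proj x p0 @^-1` A) (EFin \o w j).
    by apply: measurable_funTS; case/integrableP : (iw j).
  exact: null_set_integral mP mw (Aj j).
pose q : {nonneg R} := NngNum (ltW m2).
have E := @cyl_unique R (mscale q lam) nu.
have : mscale q lam A = nu A.
  apply: E => //.
    move=> s; have ml : mscale q lam (cyl s) = (mom2 R * (2 ^+ size s)^-1)%:E.
      by rewrite /mscale /= (lambda_cyl lamP) EFinM.
    by apply: etrans ml (etrans _ (esym (nu_cyl s))); rewrite mulrC.
  have mT : mscale q lam setT = (mom2 R)%:E.
    by rewrite /mscale /= probability_setT mule1.
  by apply: (le_lt_trans _ (ltry (mom2 R))); rewrite -mT.
rewrite nA /mscale /= => /eqP; rewrite mule_eq0 eqe gt_eqF //= => /eqP.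
exact.
Qed.

End FirstChaosMeasure.

(** * Functions with second-order bounds *)

Section SecondOrder.
Variable R : realType.
Implicit Types (K : R) (G : R[i] -> R).

(** A differentiable function with Lipschitz derivative that is 1 on the
    nonpositive reals and smaller than 1 elsewhere. *)
Definition psi (u : R) : R := (1 + Num.max 0 u ^+ 2)^-1.
Definition dpsi (u : R) : R := - (2 * Num.max 0 u) / (1 + Num.max 0 u ^+ 2) ^+ 2.

Lemma psi_bounds u : 0 < psi u <= 1.
Proof.
have h : 1 <= 1 + Num.max 0 u ^+ 2 by rewrite lerDl sqr_ge0.
by rewrite /psi invr_gt0 invf_le1 (lt_le_trans ltr01 h).
Qed.

Lemma psi_estimates u h :
  [/\ `|psi (u + h) - psi u| <= `|h|, `|dpsi u| <= 1 &
      `|psi (u + h) - psi u - dpsi u * h| <= 5 * h ^+ 2].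
Proof.
rewrite /psi /dpsi.
set a := Num.max 0 u; set b := Num.max 0 (u + h).
have a0 : 0 <= a by rewrite le_max lexx.
have b0 : 0 <= b by rewrite le_max lexx.
have pa : 1 <= 1 + a ^+ 2 by rewrite lerDl sqr_ge0.
have pb : 1 <= 1 + b ^+ 2 by rewrite lerDl sqr_ge0.
have max0 (y : R) : (y <= 0 /\ Num.max 0 y = 0) \/ (0 <= y /\ Num.max 0 y = y).
  case/orP: (le_total y 0) => y0; first by left; split=> //; exact: max_l.
  by right; split=> //; exact: max_r.
have [ab1 ab2] : `|b - a| <= `|h| /\ `|a * (b - a) - a * h| <= h ^+ 2.
  have hh := sqr_ge0 h; have hu := sqr_ge0 (2 * h + u); have uu := sqr_ge0 u.
  rewrite !ler_norml.
  rewrite /a /b; case: (max0 u) => -[u0 ->]; case: (max0 (u + h)) => -[uh ->];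
    have [h0|h0] := ger0P h; split; apply/andP; split; nra.
move: pa pb; set A := 1 + a ^+ 2; set B := 1 + b ^+ 2 => pa pb.
have A0 : 0 < A by exact: lt_le_trans ltr01 pa.
have B0 : 0 < B by exact: lt_le_trans ltr01 pb.
have pA : A^-1 * A = 1 by rewrite mulVf // gt_eqF.
have pB : B^-1 * B = 1 by rewrite mulVf // gt_eqF.
have p1 : 0 < A^-1 <= 1 by rewrite invr_gt0 A0 invf_le1.
have q1 : 0 < B^-1 <= 1 by rewrite invr_gt0 B0 invf_le1.
have aA : 2 * a <= A by rewrite /A; have := sqr_ge0 (a - 1); nra.
have abAB : a + b <= A * B.
  have : 2 * b <= B by rewrite /B; have := sqr_ge0 (b - 1); nra.
  by nra.
move: p1 q1 pA pB; set p := A^-1; set q := B^-1 => /andP[p0 p1] /andP[q0 q1] pA pB.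
pose c2 := p * q * (a + b); pose c3 := a * p.
have pq0 : 0 < p * q by exact: mulr_gt0.
have pq1 : p * q <= 1 by nra.
have c21 : 0 <= c2 <= 1.
  apply/andP; split; first by rewrite mulr_ge0 ?(ltW pq0) // addr_ge0.
  have : p * q * (a + b) <= p * q * (A * B) by rewrite ler_pM2l.
  by rewrite mulrACA pA pB mulr1.
have c31 : 0 <= 2 * c3 <= 1.
  apply/andP; split; first by rewrite !mulr_ge0 // ltW.
  have : p * (2 * a) <= p * A by rewrite ler_pM2l.
  by rewrite pA /c3; lra.
have qp : q - p = - (c2 * (b - a)).
  have -> : q - p = q * (p * A) - p * (q * B) by rewrite pA pB !mulr1.
  by rewrite /c2 /A /B; ring.
have dE : - (2 * a) / A ^+ 2 = - (2 * c3 * p).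
  by rewrite -exprVn -/p /c3; ring.
rewrite dE; set S := b - a in ab1 ab2 qp *.
set W := a * S - a * h in ab2.
(* The difference of the maxima, [S], is compared with [h] only in the product
   [a * S], since the maximum is not differentiable at 0, where [a] vanishes. *)
have E : q - p - - (2 * c3 * p) * h =
   - (p * q * S ^+ 2) - 2 * (p * q * W) + 2 * c3 * h * (c2 * S).
  have e2 : c2 * S = p - q by rewrite -[LHS]opprK -qp opprB.
  rewrite [in RHS]e2 qp /c3 /c2 /W /S.
  by ring.
case/andP: c21 => c20 c21; case/andP: c31 => c30 c31.
have SS : S ^+ 2 <= h ^+ 2.
  by rewrite -(real_normK (num_real S)) -(real_normK (num_real h)) lerXn2r ?nnegrE.
split.
- rewrite qp normrN normrM ger0_norm //; apply: le_trans ab1.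
  by rewrite -[leRHS]mul1r ler_wpM2r.
- rewrite normrN normrM (ger0_norm c30) (ger0_norm (ltW p0)).
  by rewrite -[leRHS]mulr1 ler_pM // ltW.
rewrite E; apply: le_trans (ler_normD _ _) _.
apply: le_trans (lerD (ler_normB _ _) (lexx _)) _.
rewrite normrN (ger0_norm (mulr_ge0 (ltW pq0) (sqr_ge0 S))).
have t1 : p * q * S ^+ 2 <= h ^+ 2.
  by apply: le_trans SS; rewrite -[leRHS]mul1r ler_wpM2r ?sqr_ge0.
have t2 : `|2 * (p * q * W)| <= 2 * h ^+ 2.
  rewrite !normrM (ger0_norm (ltW p0)) (ger0_norm (ltW q0)) ger0_norm //.
  rewrite ler_pM2l //; apply: le_trans ab2.
  by rewrite -[leRHS]mul1r ler_wpM2r.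
have t3 : `|2 * c3 * h * (c2 * S)| <= h ^+ 2.
  rewrite (normrM _ (c2 * S)) (normrM (2 * c3)) (normrM c2) (ger0_norm c30) (ger0_norm c20).
  have : `|h| * `|S| <= h ^+ 2.
    by rewrite -(real_normK (num_real h)) expr2 ler_wpM2l.
  move=> hS; apply: le_trans hS.
  have := normr_ge0 h; have := normr_ge0 S; move: (`|h|) (`|S|) => x y y0 x0.
  have z : 0 <= x * y by exact: mulr_ge0.
  have -> : 2 * c3 * x * (c2 * y) = (2 * c3 * c2) * (x * y) by ring.
  by rewrite -[leRHS]mul1r ler_wpM2r // -[leRHS]mulr1 ler_pM.
by have := sqr_ge0 h; lra.
Qed.

(** First and second order bounds at the origin, with a real-linear differential.
    One constant serves for all of them, and functions are bounded by 1, so that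
    the class is stable under products. *)
Definition second_order K G : Prop :=
  [/\ forall h, `|G h| <= 1, forall h, `|G h - G 0| <= K * normc h &
      exists2 ab : R * R, `|ab.1| <= K /\ `|ab.2| <= K & forall h,
        `|G h - G 0 - (ab.1 * complex.Re h + ab.2 * complex.Im h)| <=
          K * normc h ^+ 2].

Lemma le_ReIm (h : R[i]) : `|complex.Re h| <= normc h /\ `|complex.Im h| <= normc h.
Proof.
have := normc_ge0 h; have := sqr_normcE h.
have := sqr_ge0 (complex.Re h); have := sqr_ge0 (complex.Im h) => h1 h2 h3 h4.
by split; rewrite -(@ler_pXn2r _ 2) ?nnegrE ?normr_ge0 // real_normK ?num_real // h3; lra.
Qed.

Lemma second_order_psi (y : R) (a b c : R) : `|a| <= c -> `|b| <= c ->
  second_order (20 * c ^+ 2 + 2 * c)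
    (fun h => psi (y + (a * complex.Re h + b * complex.Im h))).
Proof.
move=> ac bc; have c0 : 0 <= c by exact: le_trans ac.
have lin (h : R[i]) : `|a * complex.Re h + b * complex.Im h| <= 2 * c * normc h.
  have [hr hi] := le_ReIm h; apply: le_trans (ler_normD _ _) _; rewrite !normrM.
  have : `|a| * `|complex.Re h| <= c * normc h by rewrite ler_pM.
  have : `|b| * `|complex.Im h| <= c * normc h by rewrite ler_pM.
  lra.
have c2 : 0 <= c ^+ 2 by exact: sqr_ge0.
split=> [h|h|].
- by have /andP[h1 h2] := psi_bounds (y + (a * complex.Re h + b * complex.Im h));
    rewrite ger0_norm // ltW.
- rewrite /= !mulr0 !addr0.
  have [e _ _] := psi_estimates y (a * complex.Re h + b * complex.Im h).
  apply: (le_trans e); apply: le_trans (lin h) _.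
  by apply: ler_wpM2r; [exact: normc_ge0|lra].
exists (dpsi y * a, dpsi y * b) => /=.
  have [_ d1 _] := psi_estimates y 0.
  have cc : c <= 20 * c ^+ 2 + 2 * c by lra.
  by rewrite !(normrM (dpsi y)); split; apply: le_trans cc;
    rewrite -[leRHS]mul1r ler_pM.
move=> h; rewrite /= !mulr0 !addr0 -2!(mulrA (dpsi y)) -mulrDr.
have [_ _ e] := psi_estimates y (a * complex.Re h + b * complex.Im h).
apply: (le_trans e).
have : (a * complex.Re h + b * complex.Im h) ^+ 2 <= (2 * c * normc h) ^+ 2.
  rewrite -(real_normK (num_real (a * complex.Re h + b * complex.Im h))) lerXn2r ?nnegrE //.
  by rewrite !mulr_ge0 ?normc_ge0.
have := sqr_ge0 (normc h); rewrite !exprMn => n0 l.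
have : 0 <= 2 * c * normc h ^+ 2 by rewrite !mulr_ge0 ?sqr_ge0 ?normc_ge0.
by rewrite mulrDl; nra.
Qed.

Lemma second_orderM K1 K2 G1 G2 : 0 <= K1 -> 0 <= K2 ->
  second_order K1 G1 -> second_order K2 G2 ->
  second_order (K1 + K2 + 2 * K1 * K2) (fun h => G1 h * G2 h).
Proof.
move=> K10 K20 [b1 l1 [[a1 c1] /= [a1K c1K] r1]] [b2 l2 [[a2 c2] /= [a2K c2K] r2]].
have K12 : 0 <= 2 * K1 * K2 by rewrite !mulr_ge0.
have pM (x y X Y : R) : `|x| <= X -> `|y| <= Y -> `|x * y| <= X * Y.
  by move=> hx hy; rewrite normrM ler_pM.
split=> [h|h|].
- by have := pM _ _ _ _ (b1 h) (b2 h); rewrite mulr1.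
- have -> : G1 h * G2 h - G1 0 * G2 0 = (G1 h - G1 0) * G2 h + G1 0 * (G2 h - G2 0).
    by ring.
  apply: le_trans (ler_normD _ _) _.
  have := pM _ _ _ _ (l1 h) (b2 h); have := pM _ _ _ _ (b1 0) (l2 h).
  have := mulr_ge0 K12 (normc_ge0 h); rewrite !mulrDl mulr1 mul1r.
  lra.
exists (a1 * G2 0 + G1 0 * a2, c1 * G2 0 + G1 0 * c2) => /=.
  have q (x y : R) : `|x| <= K1 -> `|y| <= K2 ->
      `|x * G2 0 + G1 0 * y| <= K1 + K2 + 2 * K1 * K2.
    move=> hx hy; apply: le_trans (ler_normD _ _) _.
    have := pM _ _ _ _ hx (b2 0); have := pM _ _ _ _ (b1 0) hy.
    by rewrite mulr1 mul1r; lra.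
  by split; exact: q.
move=> h; set x := complex.Re h; set y := complex.Im h.
set L1 := a1 * x + c1 * y; set L2 := a2 * x + c2 * y.
have -> : G1 h * G2 h - G1 0 * G2 0 -
    ((a1 * G2 0 + G1 0 * a2) * x + (c1 * G2 0 + G1 0 * c2) * y) =
    (G1 h - G1 0 - L1) * G2 h + G1 0 * (G2 h - G2 0 - L2) + L1 * (G2 h - G2 0).
  by rewrite /L1 /L2; ring.
have [hx hy] := le_ReIm h.
have L1b : `|L1| <= 2 * K1 * normc h.
  apply: le_trans (ler_normD _ _) _.
  by have := pM _ _ _ _ a1K hx; have := pM _ _ _ _ c1K hy; rewrite -/x -/y; lra.
have := pM _ _ _ _ (r1 h) (b2 h); have := pM _ _ _ _ (b1 0) (r2 h).
have := pM _ _ _ _ L1b (l2 h); rewrite -/L1 -/L2 -/x -/y => e1 e2 e3.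
apply: le_trans (ler_normD _ _) _.
apply: le_trans (lerD (ler_normD _ _) (lexx _)) _.
have -> : (K1 + K2 + 2 * K1 * K2) * normc h ^+ 2 =
  K1 * normc h ^+ 2 * 1 + 1 * (K2 * normc h ^+ 2) +
  2 * K1 * normc h * (K2 * normc h) by ring.
lra.
Qed.

End SecondOrder.

(** * Test functions and second differences *)

Section TestFunctions.
Variable R : realType.

Definition part (e : bool) (z : R[i]) : R :=
  if e then complex.Re z else complex.Im z.

(** As [n] grows, this tends to the indicator of the rectangle of all [y] such that
    [part e (y s) <= b] for the constraints [(s, (e, b))] of [L]. *)
Definition testP (L : seq (seq bool * (bool * R))) (n : nat)
    (y : seq bool -> R[i]) : R :=
  \prod_(q <- L) psi (n%:R * (part q.2.1 (y q.1) - q.2.2)).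

(** The constant depends neither on the point [y] nor on the direction [kappa] in
    which it is moved. *)
Lemma testP_second_order L n : exists2 K : R, 0 <= K &
  forall (y : seq bool -> R[i]) (kappa : seq bool -> R),
    (forall s, 0 <= kappa s <= Num.sqrt 2 ^+ size s) ->
    second_order K (fun h => testP L n (fun s => y s + (kappa s)%:C * h)).
Proof.
elim: L => [|[s [e b]] L [K K0 IH]].
  exists 0 => // y kappa _; rewrite /testP.
  split=> [h|h|].
  - by rewrite big_nil normr1.
  - by rewrite !big_nil subrr normr0 mul0r.
  exists (0, 0); first by rewrite normr0.
  by move=> h; rewrite !big_nil !mul0r addr0 subrr subr0 normr0.
pose c := n%:R * Num.sqrt 2 ^+ size s : R.
have c0 : 0 <= c by rewrite mulr_ge0 ?exprn_ge0 ?sqrtr_ge0.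
pose K1 := 20 * c ^+ 2 + 2 * c.
have K10 : 0 <= K1 by rewrite addr_ge0 // mulr_ge0 // sqr_ge0.
exists (K1 + K + 2 * K1 * K); first by rewrite !addr_ge0 // !mulr_ge0.
move=> y kappa hk; have kc : `|n%:R * kappa s| <= c.
  have /andP[h1 h2] := hk s.
  by rewrite ger0_norm ?mulr_ge0 // ler_wpM2l.
have -> : (fun h : R[i] => testP ((s, (e, b)) :: L) n (fun s => y s + (kappa s)%:C * h)) =
  fun h => psi (n%:R * (part e (y s) - b) +
    ((if e then n%:R * kappa s else 0) * complex.Re h +
     (if e then 0 else n%:R * kappa s) * complex.Im h)) *
    testP L n (fun s => y s + (kappa s)%:C * h).
  apply/funext => h; rewrite /testP big_cons; congr (psi _ * _).
  rewrite /part; case: (e) => /=.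
    by rewrite cReD cReM /=; ring.
  by rewrite cImD cImM /=; ring.
apply: second_orderM => //; last exact: IH.
by apply: second_order_psi; case: (e); rewrite ?normr0.
Qed.

Lemma testP_bounds L n y : 0 <= testP L n y <= 1.
Proof.
rewrite /testP; elim: L => [|q L /andP[h1 h2]]; first by rewrite big_nil ler01 lexx.
rewrite big_cons; have /andP[p0 p1] := psi_bounds (n%:R * (part q.2.1 (y q.1) - q.2.2)).
by rewrite mulr_ge0 ?(ltW p0) //= mulr_ile1 // ltW.
Qed.

Lemma eq_testP L n y y' : (forall q, q \in L -> y q.1 = y' q.1) ->
  testP L n y = testP L n y'.
Proof. by move=> h; apply: eq_big_seq => q qL; rewrite h. Qed.

(** The weights [1], [- tau], [tau], [-1] are the coefficients of
    [(X - 1) (X - d) (X - d^-1)]: they annihilate the sequences [1], [d ^ l] and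
    [d ^- l], hence the Taylor polynomial of degree 1. *)
Lemma second_difference (K tau : R) (G : R[i] -> R) (d eta : R[i]) : 0 <= K ->
  second_order K G -> normc d = 1 -> tau = 1 + 2 * complex.Re d ->
  `|G ((d ^+ 3 - 1) * eta) - tau * G ((d ^+ 2 - 1) * eta) +
    tau * G ((d - 1) * eta) - G 0| <= 28 * K * normc eta ^+ 2.
Proof.
move=> K0 [_ _ [[a b] _ r]] d1 tauD; rewrite /= in r.
have dd : d * d^* = 1 by rewrite mulcJ d1 expr1n.
have tauE : tau%:C = 1 + d + d^*.
  apply/eqP; rewrite eq_complex; apply/andP; split; apply/eqP.
    by rewrite !cReD cReJ /= tauD; ring.
  by rewrite !cImD cImJ /= add0r subrr.
set h3 := (d ^+ 3 - 1) * eta; set h2 := (d ^+ 2 - 1) * eta; set h1 := (d - 1) * eta.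
have z : h3 - tau%:C * h2 + tau%:C * h1 = 0.
  rewrite tauE /h1 /h2 /h3.
  have -> : (d ^+ 3 - 1) * eta - (1 + d + d^*) * ((d ^+ 2 - 1) * eta) +
     (1 + d + d^*) * ((d - 1) * eta) = (1 - d * d^*) * (d - 1) * eta by ring.
  by rewrite dd subrr !mul0r.
have [zr' zi'] : complex.Re h3 = tau * complex.Re h2 - tau * complex.Re h1 /\
    complex.Im h3 = tau * complex.Im h2 - tau * complex.Im h1.
  clearbody h1 h2 h3; case: h1 h2 h3 z => [a1 b1] [a2 b2] [a3 b3] /eqP.
  by rewrite eq_complex /= => /andP[/eqP zr /eqP zi]; split; lra.
set L := fun h => a * complex.Re h + b * complex.Im h.
have E : G h3 - tau * G h2 + tau * G h1 - G 0 =
    (G h3 - G 0 - L h3) - tau * (G h2 - G 0 - L h2) + tau * (G h1 - G 0 - L h1).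
  have : L h3 - tau * L h2 + tau * L h1 = 0.
    by rewrite /L zr' zi'; ring.
  lra.
have N (l : nat) : normc ((d ^+ l - 1) * eta) ^+ 2 <= 4 * normc eta ^+ 2.
  rewrite normcM exprMn; apply: ler_wpM2r; first exact: sqr_ge0.
  have : normc (d ^+ l - 1) <= 2.
    apply: le_trans (le_normcD _ _) _.
    by rewrite normcN normc1 normcX d1 expr1n.
  have := normc_ge0 (d ^+ l - 1); nra.
have tau3 : `|tau| <= 3.
  have [hr _] := le_ReIm d; move: hr; rewrite d1 !ler_norml tauD => /andP[? ?].
  by apply/andP; split; lra.
have B (h : R[i]) : normc h ^+ 2 <= 4 * normc eta ^+ 2 ->
    `|G h - G 0 - L h| <= 4 * K * normc eta ^+ 2.
  move=> hn; apply: le_trans (r h) _.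
  by rewrite -mulrA (mulrCA 4) ler_wpM2l.
have B1 := B _ (N 1%N); rewrite expr1 -/h1 in B1.
have B2 := B _ (N 2); rewrite -/h2 in B2; have B3 := B _ (N 3); rewrite -/h3 in B3.
have T (x y : R) : `|x| <= y -> `|tau * x| <= 3 * y.
  by move=> xy; rewrite normrM ler_pM.
rewrite E; apply: le_trans (ler_normD _ _) _.
apply: le_trans (lerD (ler_normB _ _) (lexx _)) _.
have := T _ _ B1; have := T _ _ B2; lra.
Qed.

(** The same polynomial at [d ^ m], which is none of its roots. *)
Lemma second_difference_char (tau : R) (d : R[i]) (m : int) : normc d = 1 ->
  d ^ m != 1 -> d ^ (m - 1) != 1 -> d ^ (m + 1) != 1 ->
  tau = 1 + 2 * complex.Re d ->
  (d ^ m) ^+ 3 - tau%:C * (d ^ m) ^+ 2 + tau%:C * d ^ m - 1 != 0.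
Proof.
move=> d1 h0 h1 h2 tauD.
have d0 := unit_neq0 d1.
have dd : d * d^* = 1 by rewrite mulcJ d1 expr1n.
have tauE : tau%:C = 1 + d + d^*.
  apply/eqP; rewrite eq_complex; apply/andP; split; apply/eqP.
    by rewrite !cReD cReJ /= tauD; ring.
  by rewrite !cImD cImJ /= add0r subrr.
set x := d ^ m in h0 *.
have -> : x ^+ 3 - tau%:C * x ^+ 2 + tau%:C * x - 1 =
    (x - 1) * (x - d) * (x - d^*) + (d * d^* - 1) * (1 - x).
  by rewrite tauE; ring.
rewrite dd subrr mul0r addr0 !mulf_eq0 !negb_or !subr_eq0 h0 /=.
apply/andP; split.
  apply: contra h1 => /eqP e.
  by rewrite expfzDr // -/x e exprN1 mulfV.
apply: contra h2 => /eqP e.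
by rewrite expfzDr // -/x e expr1z mulrC dd.
Qed.

End TestFunctions.

(** * Inner products with bounded real functions *)

Section RealSecondSlot.
Context (R : realType) d (T : measurableType d).
Variable mu : {measure set T -> \bar R}.

Lemma L2ip_linr (a : R) (f g h : T -> R[i]) : L2 mu f -> L2 mu g -> L2 mu h ->
  L2ip mu f (fun t => a%:C * g t + h t) = a%:C * L2ip mu f g + L2ip mu f h.
Proof.
move=> fL gL hL; have aJ : (a%:C)^* = a%:C :> R[i].
  by apply/eqP; rewrite eq_complex /= oppr0 !eqxx.
rewrite /L2ip.
have -> : (fun t => f t * (a%:C * g t + h t)^*) =
    fun t => a%:C * (f t * (g t)^*) + f t * (h t)^*.
  by apply/funext => t; rewrite rmorphD rmorphM /= aJ; ring.
rewrite cintegralD ?cintegralZ //; try exact: integrableC_mulJ.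
by apply: integrableCZ; exact: integrableC_mulJ.
Qed.

End RealSecondSlot.

Section BoundedFunctions.
Context (R : realType) d (T : measurableType d).
Variable mu : {finite_measure set T -> \bar R}.

Lemma bounded_L2 (f : T -> R[i]) (B : R) : measurable_fun setT f ->
  (forall t, normc (f t) ^+ 2 <= B) -> L2 mu f.
Proof.
move=> mf fB; apply: integrable_L2 => //.
apply: (le_integrableR (v := fun=> B)).
- exact: measurable_sqr_normc.
- by move=> t; rewrite ger0_norm ?sqr_ge0.
- exact: finite_measure_integrable_cst.
Qed.

Lemma normc_real (r : R) : normc r%:C ^+ 2 = r ^+ 2.
Proof. by rewrite sqr_normcE /= expr0n addr0. Qed.

Lemma measurable_realC (P : T -> R) : measurable_fun setT P ->
  measurable_fun setT (fun t => (P t)%:C : R[i]).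
Proof. by move=> mP; apply/measurable_ReIm; split. Qed.

Lemma real_L2 (P : T -> R) (B : R) : measurable_fun setT P ->
  (forall t, `|P t| <= B) -> L2 mu (fun t => (P t)%:C).
Proof.
move=> mP PB; apply: (@bounded_L2 _ (B ^+ 2)); first exact: measurable_realC.
move=> t; rewrite normc_real -(real_normK (num_real (P t))).
by rewrite lerXn2r ?nnegrE // (le_trans _ (PB t)).
Qed.

Lemma measurable_part e (f : T -> R[i]) : measurable_fun setT f ->
  measurable_fun setT (fun t => part e (f t)).
Proof. by case: e => /measurable_ReIm[]. Qed.

Lemma measurable_psi (f : T -> R) : measurable_fun setT f ->
  measurable_fun setT (fun t => psi (f t)).
Proof.
move=> mf; have -> : (fun t => psi (f t)) = @psi R \o f by [].
apply: measurableT_comp mf; apply: continuous_measurable_fun => u.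
apply/cvgrPdist_le => e e0; near=> x.
have [h _ _] := psi_estimates u (x - u).
have e1 : u + (x - u) = x by ring.
rewrite e1 in h; rewrite distrC; apply: le_trans h _.
rewrite distrC; near: x; exact: cvgr_dist_le.
Unshelve. all: by end_near. Qed.

Lemma measurable_testP L n (y : T -> seq bool -> R[i]) :
  (forall s, measurable_fun setT (fun t => y t s)) ->
  measurable_fun setT (fun t => testP L n (y t)).
Proof.
move=> my; rewrite /testP; elim: L => [|q L ih].
  by under eq_fun do rewrite big_nil; exact: measurable_cst.
under eq_fun do rewrite big_cons; apply: measurable_funM ih.
apply: measurable_psi; apply: measurable_funM; first exact: measurable_cst.
by apply: measurable_funB; [exact: measurable_part|exact: measurable_cst].
Qed.

End BoundedFunctions.

(** * Vectors of higher weight *)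

Section LocalVectors.
Variables (R : realType) (lam : probability cantor R)
  (gam : probability (Xinf R) R)
  (alpha : (cantor -> R[i]) -> Xinf R -> Xinf R)
  (mu : forall x : idx, nat -> {finite_measure set (C_ x) -> \bar R}).
Hypothesis act : boolean_action lam gam alpha.
Variable U : (Xinf R -> R[i]) -> forall i : idx * nat, C_ i.1 -> R[i].
Arguments U : clear implicits.
Hypothesis sm : spectral_map gam alpha mu U.
Variables (m : int) (x : idx).
Hypothesis xm : single x m.

Let i0 : idx * nat := (x, 0%N).

Definition over (t : seq bool) (y : idx) : set (C_ y) :=
  [set a | forall p : D y, pre (size t) (a p) = t].
Arguments over : clear implicits.

(** In the spectral form, the indicator of the points of the component [(x, 0)]
    that lie over the cylinder of [t]. *)
Definition local_vec (t : seq bool) (i : idx * nat) (a : C_ i.1) : R[i] :=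
  if (i == i0) && (a \in over t i.1) then 1 else 0.
Arguments local_vec : clear implicits.

Lemma local_vec_out t i a : i != i0 -> local_vec t i a = 0.
Proof. by rewrite /local_vec => /negbTE ->. Qed.

Lemma measurable_over t y : measurable (over t y).
Proof.
have -> : over t y = \big[setI/setT]_(p : D y) (@Defs.proj y p @^-1` cyl t).
  apply/seteqP; split=> a; rewrite -bigcap_seq /=.
    by move=> h p _; exact: h.
  by move=> h p; apply: (h p); rewrite /= mem_index_enum.
apply: bigsetI_measurable => p _.
have := measurable_proj p measurableT (measurable_cyl t).
by rewrite setTI.
Qed.

Lemma measurable_local_vec t i : measurable_fun setT (local_vec t i).
Proof.
rewrite /local_vec; case: (i == i0) => /=; last exact: measurable_cst.
apply: measurable_fun_ifT => //.
apply: (@measurable_fun_bool _ _ _ _ true); rewrite setTI.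
suff -> : (fun a : C_ i.1 => a \in over t i.1) @^-1` [set true] = over t i.1.
  exact: measurable_over.
by apply/seteqP; split=> a /=; [exact: set_mem|exact: mem_set].
Qed.

Lemma normc_local_vec t i a : normc (local_vec t i a) ^+ 2 <= 1.
Proof.
rewrite /local_vec; case: ifP => _; first by rewrite normc1 expr1n.
by rewrite normc0 expr0n ler01.
Qed.

Lemma local_vec_hilb t i : @hilb R (rho (mu i.1 i.2)) (local_vec t i).
Proof.
split.
  apply: (@bounded_L2 _ _ _ _ _ 1); first exact: measurable_local_vec.
  exact: normc_local_vec.
move=> delta _; apply: aeW => a _ /=.
rewrite /local_vec; congr (if _ && _ then _ else _).
apply/idP/idP; rewrite !inE => h p.
  by have := h (delta p); rewrite /good_homeo permK.
exact: h.
Qed.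

Lemma local_vec_summable t :
  (\esum_(i in [set: idx * nat])
    (Rintegral (mu i.1 i.2) setT (fun a => normc (local_vec t i a) ^+ 2))%:E < +oo)%E.
Proof.
pose b (i : idx * nat) :=
  (Rintegral (mu i.1 i.2) setT (fun a => normc (local_vec t i a) ^+ 2))%:E.
have -> : (\esum_(i in [set: idx * nat]) b i = \esum_(i in [set i0]) b i)%E.
  rewrite [RHS]esum_mkcond; apply: eq_esum => i _; case: ifPn => // ni.
  have ii : i != i0 by apply: contra ni => /eqP ->; rewrite inE.
  rewrite /b /Rintegral; under eq_integral do rewrite local_vec_out // normc0 expr0n /=.
  by rewrite integral0.
rewrite esum_set1 ?ltry // lee_fin.
by apply: Rintegral_ge0 => a _; exact: sqr_ge0.
Qed.

Lemma local_vec_sum n i a :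
  local_vec [::] i a = \sum_(t : n.-tuple bool) local_vec t i a.
Proof.
rewrite /local_vec; case: eqP => [ii|_] /=; last by rewrite big1.
subst i; have -> : (a \in over [::] i0.1) by rewrite inE.
pose p0 := pt xm; pose t0 : n.-tuple bool := [tuple of mkseq (a p0) n].
rewrite (bigD1 t0) //= big1 ?addr0 => [|t tt0].
  rewrite ifT // inE => p; rewrite (single_uniq xm p).
  by rewrite /pre size_mkseq.
rewrite ifF //; apply/negbTE; apply: contra tt0; rewrite inE => h.
apply/eqP/val_inj => /=; rewrite -[LHS](h p0) size_tuple.
by [].
Qed.

Lemma local_vec_char t c i a : c != 0 ->
  char_fun (stepf t c) a * local_vec t i a = c ^ m * local_vec t i a.
Proof.
move=> c0; rewrite /local_vec; case: eqP => [ii|_] /=; last by rewrite !mulr0.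
subst i; case: ifPn => [|_]; last by rewrite !mulr0.
rewrite inE => h; congr (_ * _); rewrite char_fun_stepf //; congr (_ ^ _).
rewrite (big_pred1 (pt xm)) ?(single_D _ xm) // => p.
rewrite /= h eqxx; apply/esym/eqP; exact: single_uniq.
Qed.

Lemma local_preimage : exists v : seq bool -> Xinf R -> R[i], forall t,
  nonfixed gam alpha (v t) /\
  forall i, \forall a \ae mu i.1 i.2, U (v t) i a = local_vec t i a.
Proof.
have /choice[v vP] (t : seq bool) : exists w, nonfixed gam alpha w /\
    forall i, \forall a \ae mu i.1 i.2, U w i a = local_vec t i a.
  have [w wN wE] := sm_surj sm (local_vec_hilb t) (local_vec_summable t).
  by exists w.
by exists v.
Qed.

Variable v : seq bool -> Xinf R -> R[i].
Hypothesis vP : forall t, nonfixed gam alpha (v t) /\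
  forall i, \forall a \ae mu i.1 i.2, U (v t) i a = local_vec t i a.

Lemma local_split n : \forall f \ae gam,
  v [::] f = \sum_(t : n.-tuple bool) v t f.
Proof.
have N (t : n.-tuple bool) : nonfixed gam alpha (v t) by case: (vP t).
apply: (sm_inj sm (vP [::]).1 (nonfixed_sum _ N)) => i.
have h : \forall a \ae mu i.1 i.2, forall t : n.-tuple bool,
    U (v t) i a = local_vec t i a.
  by apply: filter_forall => t; exact: (vP t).2.
apply: filterS3 (sm_sum sm (index_enum _) N i) ((vP [::]).2 i) h.
move=> a -> -> H; rewrite (local_vec_sum n).
by apply: eq_bigr => t _; rewrite H.
Qed.

Lemma local_eigen t c : normc c = 1 ->
  \forall f \ae gam, koop alpha (stepf t c) (v t) f = c ^ m * v t f.
Proof.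
move=> c1; have Lp := L0T_stepf t c1; have c0 := unit_neq0 c1.
have [vN vU] := vP t.
apply: (sm_inj sm (nonfixed_koop act Lp vN) (nonfixed_scale _ vN)) => i.
apply: filterS3 (sm_equiv sm Lp vN i) (sm_scale sm (c ^ m) vN i) (vU i).
by move=> a -> -> ->; exact: local_vec_char.
Qed.

Definition total_mass : R :=
  Rintegral (mu x 0%N) setT (fun a => normc (local_vec [::] i0 a) ^+ 2).

Lemma local_norm t : Rintegral gam setT (fun f => normc (v t f) ^+ 2) =
  Rintegral (mu x 0%N) setT (fun a => normc (local_vec t i0 a) ^+ 2).
Proof.
have [vN vU] := vP t.
apply: EFin_inj; rewrite -(sm_norm sm vN).
pose b (i : idx * nat) :=
  (Rintegral (mu i.1 i.2) setT (fun a => normc (U (v t) i a) ^+ 2))%:E.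
have bE i : b i = (Rintegral (mu i.1 i.2) setT (fun a => normc (local_vec t i a) ^+ 2))%:E.
  rewrite /b /Rintegral; congr (fine _)%:E; apply: ae_eq_integral => //.
  - by apply/measurable_EFinP; exact: measurable_sqr_normc (sm_L2 sm vN i).1.
  - apply/measurable_EFinP; apply: (@measurable_sqr_normc _ _ _ (local_vec t i)).
    exact: measurable_local_vec.
  - by apply: filterS (vU i) => a ->.
have -> : (\esum_(i in [set: idx * nat]) b i = \esum_(i in [set i0]) b i)%E.
  rewrite [RHS]esum_mkcond; apply: eq_esum => i _; case: ifPn => // ni.
  have ii : i != i0 by apply: contra ni => /eqP ->; rewrite inE.
  rewrite bE /Rintegral; under eq_integral do rewrite local_vec_out // normc0 expr0n /=.
  by rewrite integral0.
rewrite esum_set1 ?bE // lee_fin.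
by apply: Rintegral_ge0 => a _; exact: sqr_ge0.
Qed.

Lemma local_norm_sum n :
  \sum_(t : n.-tuple bool) Rintegral gam setT (fun f => normc (v t f) ^+ 2) =
  total_mass.
Proof.
under eq_bigr do rewrite local_norm.
have iL (t : seq bool) : L2 (mu x 0%N) (local_vec t i0).
  by case: (local_vec_hilb t i0).
have h (s : seq (n.-tuple bool)) :
   \sum_(t <- s) Rintegral (mu x 0%N) setT (fun a => normc (local_vec t i0 a) ^+ 2) =
   Rintegral (mu x 0%N) setT (fun a => \sum_(t <- s) normc (local_vec t i0 a) ^+ 2) /\
   (mu x 0%N).-integrable setT (EFin \o
     (fun a => \sum_(t <- s) normc (local_vec t i0 a) ^+ 2)).
  elim: s => [|t s [ih1 ih2]].
    split; first by rewrite big_nil /Rintegral;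
      under eq_integral do rewrite big_nil; rewrite integral0.
    rewrite (_ : EFin \o _ = cst 0%E); first exact: integrable0.
    by apply/funext => a; rewrite /= big_nil.
  split.
    rewrite big_cons ih1 -RintegralD //; last exact: L2_integrable (iL t).
    by apply: eq_Rintegral => a _; rewrite big_cons.
  rewrite (_ : (fun a => \sum_(k <- t :: s) _) = fun a =>
    normc (local_vec t i0 a) ^+ 2 + \sum_(k <- s) normc (local_vec k i0 a) ^+ 2).
    by apply: integrableRD ih2; exact: L2_integrable (iL t).
  by apply/funext => a; rewrite big_cons.
rewrite (h _).1; apply: eq_Rintegral => a _.
have z (t : n.-tuple bool) : normc (local_vec t i0 a) ^+ 2 =
    complex.Re (local_vec t i0 a).
  rewrite /local_vec; case: ifP => _; first by rewrite normc1 expr1n.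
  by rewrite normc0 expr0n.
have zs : normc (local_vec [::] i0 a) ^+ 2 = complex.Re (local_vec [::] i0 a).
  rewrite /local_vec; case: ifP => _; first by rewrite normc1 expr1n.
  by rewrite normc0 expr0n.
have Re0 : complex.Re (0 : R[i]) = 0 by [].
rewrite zs (local_vec_sum n) (big_morph (@complex.Re R) (@cReD R) Re0).
by apply: eq_bigr => t _; rewrite z.
Qed.

End LocalVectors.

(** * Orthogonality to the test functions *)

Section FirstSlot.
Context (R : realType) d (T : measurableType d).
Variable mu : {measure set T -> \bar R}.

Lemma L2ip_ael (f g h : T -> R[i]) : L2 mu f -> L2 mu g -> L2 mu h ->
  (\forall t \ae mu, f t = g t) -> L2ip mu f h = L2ip mu g h.
Proof.
move=> [mf _] [mg _] [mh _] fg; have mhJ := measurable_conjC mh.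
apply: cintegral_ae; try exact: measurable_mulC.
by apply: filterS fg => t ->.
Qed.

Lemma L2ip_suml (I : Type) (s : seq I) (F : I -> T -> R[i]) (h : T -> R[i]) :
  (forall j, L2 mu (F j)) -> L2 mu h ->
  L2ip mu (fun t => \sum_(j <- s) F j t) h = \sum_(j <- s) L2ip mu (F j) h.
Proof.
move=> FL hL; rewrite /L2ip -cintegral_sum; last first.
  by move=> j; exact: integrableC_mulJ.
by congr cintegral; apply/funext => t; rewrite mulr_suml.
Qed.

Lemma L2ipZl (a : R[i]) (f h : T -> R[i]) : L2 mu f -> L2 mu h ->
  L2ip mu (fun t => a * f t) h = a * L2ip mu f h.
Proof.
move=> fL hL; rewrite /L2ip -cintegralZ; last exact: integrableC_mulJ.
by congr cintegral; apply/funext => t; rewrite mulrA.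
Qed.

End FirstSlot.

Lemma half_sum_ge (R : realType) (a b c : R) :
  0 <= a - 2 * b + c -> b <= 2^-1 * (a + c).
Proof. lra. Qed.

Section HigherWeight.
Variables (R : realType) (lam : probability cantor R)
  (gam : probability (Xinf R) R)
  (alpha : (cantor -> R[i]) -> Xinf R -> Xinf R)
  (mu : forall x : idx, nat -> {finite_measure set (C_ x) -> \bar R}).
Hypothesis act : boolean_action lam gam alpha.
Hypothesis gammaP : is_gamma_inf gam.

(** The coefficient with which a change of [eta_ t f] enters the coordinate at [s]. *)
Definition kap (t s : seq bool) : R :=
  if take (size s) t == s then Num.sqrt 2 ^+ size s else 0.

Definition eta_ (t : seq bool) (f : Xinf R) : R[i] := sc R (size t) * Xval f t.

(** The value of the test function after the rotation by [c] over the cylinder of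
    [t], given everywhere by the formula that is valid almost everywhere. *)
Definition rotP L n t (c : R[i]) (f : Xinf R) : R :=
  testP L n (fun s => Xval f s + (kap t s)%:C * ((c - 1) * eta_ t f)).

Lemma kap_bounds t s : 0 <= kap t s <= Num.sqrt 2 ^+ size s.
Proof.
by rewrite /kap; case: ifP => _; rewrite ?lexx ?exprn_ge0 ?sqrtr_ge0.
Qed.

Lemma rotP1 L n t f : rotP L n t 1 f = testP L n (Xval f).
Proof. by apply: eq_testP => q _; rewrite subrr mul0r mulr0 addr0. Qed.

Lemma rotP_act L n t c : normc c = 1 ->
  (forall q, q \in L -> (size q.1 <= size t)%N) ->
  \forall f \ae gam, testP L n (Xval (alpha (stepf t c) f)) = rotP L n t c f.
Proof.
move=> c1 Lt; apply: filterS (act_stepf act t c1) => f h.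
apply: eq_testP => q /Lt qt; rewrite (h _ qt); congr (_ + _).
rewrite /kap; case: ifP => _; last by rewrite mul0r.
rewrite /eta_ -[in RHS](subnK qt) scD -/(sc R (size t - size q.1)).
have e : (Num.sqrt 2 ^+ size q.1)%:C * sc R (size q.1) = 1.
  rewrite /sc rmorphXn mulfV // expf_neq0 // eq_complex /= eqxx andbT.
  by rewrite sqrtr_eq0 -ltNge.
rewrite [RHS](_ : _ = ((Num.sqrt 2 ^+ size q.1)%:C * sc R (size q.1)) *
  ((c - 1) * sc R (size t - size q.1) * Xval f t)); last by ring.
by rewrite e mul1r.
Qed.

Lemma measurable_rotP L n t c : measurable_fun setT (rotP L n t c).
Proof.
apply: measurable_testP => s; apply: measurable_addC; first exact: measurable_Xval.
do 3 (apply: measurable_mulC; first exact: measurable_cst).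
exact: measurable_Xval.
Qed.

Lemma rotP_norm L n t c f : `|rotP L n t c f| <= 1.
Proof. by have /andP[h0 h1] := testP_bounds L n (fun s => Xval f s + (kap t s)%:C * ((c - 1) * eta_ t f)); rewrite ger0_norm. Qed.

Lemma L2_rotP L n t c : L2 gam (fun f => (rotP L n t c f)%:C).
Proof. by apply: (real_L2 _ (measurable_rotP L n t c)) => f; exact: rotP_norm. Qed.

Lemma normc_eta t f : normc (eta_ t f) ^+ 2 = (2 ^+ size t)^-1 * normc (Xval f t) ^+ 2.
Proof. by rewrite normcM exprMn normc_sc. Qed.

Variables (m : int) (v : seq bool -> Xinf R -> R[i]).
Hypothesis vL : forall t, L2 gam (v t).
Hypothesis v_eigen : forall t c, normc c = 1 ->
  \forall f \ae gam, koop alpha (stepf t c) (v t) f = c ^ m * v t f.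

Let P L n := fun f : Xinf R => (testP L n (Xval f))%:C : R[i].

Let PL L n : L2 gam (P L n).
Proof.
have := L2_rotP L n [::] 1; congr (L2 gam _).
by apply/funext => f; rewrite rotP1.
Qed.

(** The rotation preserves inner products and multiplies [v t] by a power of
    [d ^ m]. *)
Lemma ip_rotP L n t d l : normc d = 1 ->
  (forall q, q \in L -> (size q.1 <= size t)%N) ->
  L2ip gam (v t) (fun f => (rotP L n t (d ^+ l) f)%:C) =
  (d ^ m) ^+ l * L2ip gam (v t) (P L n).
Proof.
move=> d1 Lt; have dl1 : normc (d ^+ l) = 1 by rewrite normcX d1 expr1n.
have c1 : normc (d ^+ l)^-1 = 1 by rewrite normcV dl1 invr1.
have Lp := L0T_stepf t c1.
have -> : L2ip gam (v t) (P L n) = ((d ^+ l)^-1) ^ m *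
    L2ip gam (v t) (fun f => (rotP L n t (d ^+ l) f)%:C).
  rewrite -(koop_ip act Lp (vL t) (PL L n)) -(L2ipZl _ (vL t) (L2_rotP L n t (d ^+ l))).
  rewrite (L2ip_ael (L2_koop act Lp (vL t)) (L2Z _ (vL t)) (L2_koop act Lp (PL L n)) (v_eigen t c1)).
  apply: L2ip_ae; [exact: L2Z|exact: (L2_koop act Lp (PL L n))|exact: L2_rotP|].
  apply: filterS (rotP_act n dl1 Lt) => f h.
  by rewrite /koop /P stepf_inv invrK h.
have d0 := unit_neq0 d1.
have e : (d ^ m) ^+ l * ((d ^+ l)^-1) ^ m = 1.
  rewrite exprz_inv -invr_expz !exprnP !exprz_exp [(l%:Z * m)%R]mulrC mulfV //.
  exact: expfz_neq0.
by rewrite mulrA e mul1r.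
Qed.

Variable d : R[i].
Hypothesis d1 : normc d = 1.
Let tau : R := 1 + 2 * complex.Re d.

Definition diffP L n t (f : Xinf R) : R :=
  rotP L n t (d ^+ 3) f - tau * rotP L n t (d ^+ 2) f +
  tau * rotP L n t (d ^+ 1) f - rotP L n t 1 f.

Definition diff_factor : R[i] :=
  (d ^ m) ^+ 3 - tau%:C * (d ^ m) ^+ 2 + tau%:C * d ^ m - 1.

Let diffPE L n t (f : Xinf R) : (diffP L n t f)%:C =
  (-1)%:C * (rotP L n t 1 f)%:C + (tau%:C * (rotP L n t (d ^+ 1) f)%:C +
   ((- tau)%:C * (rotP L n t (d ^+ 2) f)%:C + (rotP L n t (d ^+ 3) f)%:C)).
Proof.
apply/eqP; rewrite eq_complex /= /diffP.
by apply/andP; split; apply/eqP; ring.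
Qed.

Lemma L2_diffP L n t : L2 gam (fun f => (diffP L n t f)%:C).
Proof.
rewrite (_ : (fun f => _) = (fun f => (-1)%:C * (rotP L n t 1 f)%:C +
  (tau%:C * (rotP L n t (d ^+ 1) f)%:C +
   ((- tau)%:C * (rotP L n t (d ^+ 2) f)%:C + (rotP L n t (d ^+ 3) f)%:C)))).
  by do 3 (apply: L2_lin; first exact: L2_rotP); exact: L2_rotP.
by apply/funext => f; exact: diffPE.
Qed.

Lemma ip_diffP L n t : (forall q, q \in L -> (size q.1 <= size t)%N) ->
  L2ip gam (v t) (fun f => (diffP L n t f)%:C) =
  diff_factor * L2ip gam (v t) (P L n).
Proof.
move=> Lt; pose r c f := (rotP L n t c f)%:C.
have rL c : L2 gam (r c) by exact: L2_rotP.
rewrite (_ : (fun f => _) = (fun f => (-1)%:C * r 1 f +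
  (tau%:C * r (d ^+ 1) f + ((- tau)%:C * r (d ^+ 2) f + r (d ^+ 3) f)))); last first.
  by apply/funext => f; exact: diffPE.
have L23 := L2_lin (- tau)%:C (rL (d ^+ 2)) (rL (d ^+ 3)).
have L13 := L2_lin tau%:C (rL (d ^+ 1)) L23.
rewrite (L2ip_linr (-1) (vL t) (rL 1) L13) (L2ip_linr tau (vL t) (rL (d ^+ 1)) L23).
rewrite (L2ip_linr (- tau) (vL t) (rL (d ^+ 2)) (rL (d ^+ 3))).
have e l : L2ip gam (v t) (r (d ^+ l)) = (d ^ m) ^+ l * L2ip gam (v t) (P L n).
  exact: ip_rotP.
have e0 : L2ip gam (v t) (r 1) = L2ip gam (v t) (P L n).
  by have := e 0%N; rewrite !expr0 mul1r.
rewrite e0 (e 1%N) (e 2%N) (e 3%N) /diff_factor.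
have -> : (-1)%:C = -1 :> R[i] by rewrite rmorphN1.
have -> : (- tau)%:C = - tau%:C :> R[i] by rewrite rmorphN.
move: (L2ip _ _ _) (d ^ m) (tau%:C) => X Y Z.
by rewrite expr1; ring.
Qed.

(** A second difference in a direction of squared length [2 ^- size t] times a
    Gaussian variable. *)
Lemma diffP_bound L n : exists2 K : R, 0 <= K & forall t f,
  `|diffP L n t f| <= K * ((2 ^+ size t)^-1 * normc (Xval f t) ^+ 2).
Proof.
have [K K0 H] := testP_second_order (R := R) L n.
exists (28 * K) => [|t f]; first by rewrite mulr_ge0.
have := second_difference (eta_ t f) K0 (H (Xval f) (kap t) (kap_bounds t)) d1 (erefl tau).
rewrite normc_eta /diffP rotP1 /rotP expr1; congr (_ <= _); congr `|_ - _|.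
by apply: eq_testP => q _; rewrite mulr0 addr0.
Qed.

(** Pointwise [2 a b <= e a ^ 2 + e^-1 b ^ 2], where [b ^ 2] is controlled by the
    fourth power of a Gaussian coordinate. *)
Lemma local_bound L n : exists2 C : R, 0 <= C & forall t e, 0 < e ->
  (forall q, q \in L -> (size q.1 <= size t)%N) ->
  normc diff_factor * normc (L2ip gam (v t) (P L n)) <=
  e * Rintegral gam setT (fun f => normc (v t f) ^+ 2) +
  e^-1 * (C * (4 ^+ size t)^-1).
Proof.
have [K K0 HK] := diffP_bound L n.
have m40 : 0 <= mom4 R by apply: Rintegral_ge0 => p _; rewrite exprn_ge0 ?normc_ge0.
exists (K ^+ 2 * mom4 R) => [|t e e0 Lt]; first by rewrite mulr_ge0 ?sqr_ge0.
rewrite -normcM -ip_diffP // /L2ip.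
pose B := K ^+ 2 * (4 ^+ size t)^-1.
pose u f := 2^-1 * (e * normc (v t f) ^+ 2 + e^-1 * (B * normc (Xval f t) ^+ 4)).
have iv := L2_integrable (vL t).
have i4 := integrable_Xval4 gammaP t.
have iu : gam.-integrable setT (EFin \o u).
  by do 2 (apply: integrableRZ || apply: integrableRD);
    do ?apply: integrableRZ.
apply: le_trans (le_cintegral (integrableC_mulJ (vL t) (L2_diffP L n t)) iu _) _.
  move=> f; have hv := normc_ge0 (v t f).
  have hq := HK t f; set q := diffP L n t f in hq *.
  have -> : normc (v t f * (q%:C)^*) = normc (v t f) * `|q|.
    rewrite normcM normc_conj; congr (_ * _).
    by rewrite /= expr0n addr0 sqrtr_sqr.
  set X := normc (Xval f t) in hq *; have X0 : 0 <= X by exact: normc_ge0.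
  set z := K * ((2 ^+ size t)^-1 * X ^+ 2) in hq.
  have zE : z ^+ 2 = B * X ^+ 4.
    have e4 : (4 : R) ^+ size t = (2 ^+ size t) ^+ 2.
      by rewrite -exprM mulnC exprM; congr (_ ^+ _); ring.
    by rewrite /z /B e4 (exprM X 2 2) !exprMn exprVn mulrA.
  rewrite /u -/X -zE.
  have z0 : 0 <= z by exact: le_trans (normr_ge0 q) hq.
  have h1 : normc (v t f) * `|q| <= normc (v t f) * z by rewrite ler_wpM2l.
  apply: le_trans h1 _; move: (normc (v t f)) hv => w w0.
  have ei : e^-1 * e = 1 by rewrite mulVf // gt_eqF.
  have ei0 : 0 < e^-1 by rewrite invr_gt0.
  have h2 : 0 <= e^-1 * (e * w - z) ^+ 2 by rewrite mulr_ge0 ?sqr_ge0 ?ltW.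
  have h3 : e^-1 * (e * w - z) ^+ 2 = (e^-1 * e) * (e * w ^+ 2) -
     2 * (e^-1 * e) * (w * z) + e^-1 * z ^+ 2 by ring.
  rewrite h3 ei mul1r mulr1 in h2.
  exact: half_sum_ge h2.
rewrite /u RintegralZl //; last first.
  by apply: integrableRD; do ?apply: integrableRZ.
rewrite RintegralD //; [|by do ?apply: integrableRZ..].
rewrite !RintegralZl //; [|by do ?apply: integrableRZ..].
rewrite (Rintegral_Xval4 gammaP).
have two : 2 * 2^-1 = 1 :> R by rewrite mulfV.
rewrite (mulrA 2) two mul1r lerD2l.
by rewrite /B (mulrAC _ _ (mom4 R)).
Qed.

Variable V : R.
Hypothesis v_split : forall n, \forall f \ae gam,
  v [::] f = \sum_(t : n.-tuple bool) v t f.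
Hypothesis v_norm : forall n,
  \sum_(t : n.-tuple bool) Rintegral gam setT (fun f => normc (v t f) ^+ 2) = V.
Hypothesis factor_neq0 : diff_factor != 0.

(** Summed over the [2 ^ M] sequences of length [M], [local_bound] leaves [e V] and a
    term of size [2 ^- M / e]. *)
Lemma ip_testP0 L n : L2ip gam (v [::]) (P L n) = 0.
Proof.
have [C C0 HC] := local_bound L n.
pose M0 := \max_(q <- L) size q.1.
have LM M (t : M.-tuple bool) : (M0 <= M)%N ->
    forall q, q \in L -> (size q.1 <= size t)%N.
  move=> MM q qL; rewrite size_tuple (leq_trans _ MM) //.
  by rewrite /M0 (big_rem q qL) /= leq_maxl.
set I0 := L2ip gam _ _; pose N := normc diff_factor * normc I0.
have V0 : 0 <= V.
  rewrite -(v_norm 0); apply: sumr_ge0 => t _.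
  by apply: Rintegral_ge0 => f _; exact: sqr_ge0.
have step M e : (M0 <= M)%N -> 0 < e -> N <= e * V + e^-1 * (C * (2 ^+ M)^-1).
  move=> MM e0; rewrite /N /I0.
  have sL : L2 gam (fun f => \sum_(t : M.-tuple bool) v t f) by exact: L2_sum.
  rewrite (L2ip_ael (vL [::]) sL (PL L n) (v_split M)).
  rewrite (L2ip_suml _ (fun t : M.-tuple bool => vL t) (PL L n)).
  have tri (s : seq (M.-tuple bool)) : normc (\sum_(t <- s) L2ip gam (v t) (P L n)) <=
      \sum_(t <- s) normc (L2ip gam (v t) (P L n)).
    elim: s => [|t s ih]; first by rewrite !big_nil normc0.
    rewrite !big_cons; apply: le_trans (le_normcD _ _) _; exact: lerD.
  apply: le_trans (ler_wpM2l (normc_ge0 _) (tri _)) _.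
  rewrite mulr_sumr.
  have bound (t : M.-tuple bool) : normc diff_factor * normc (L2ip gam (v t) (P L n)) <=
      e * Rintegral gam setT (fun f => normc (v t f) ^+ 2) + e^-1 * (C * (4 ^+ M)^-1).
    by have := HC t e e0 (LM M t MM); rewrite size_tuple.
  apply: le_trans (ler_sum _ (fun t _ => bound t)) _.
  rewrite big_split /= -mulr_sumr v_norm lerD2l sumr_const card_tuple card_bool.
  rewrite -[leLHS]mulr_natr natrX -!mulrA ler_pM2l ?invr_gt0 // ler_wpM2l //.
  have -> : (4 : R) ^+ M = 2 ^+ M * 2 ^+ M by rewrite -exprMn -natrM.
  by rewrite invfM -mulrA mulVf ?mulr1 // expf_neq0.
have small e : 0 < e -> N <= e * (V + 1).
  move=> e0; have ee : 0 < e * e by exact: mulr_gt0.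
  pose M1 := (Num.truncn (C / (e * e))).+1; pose M := maxn M0 M1.
  have MC : C / (e * e) <= 2 ^+ M.
    have h1 : C / (e * e) <= M1%:R by apply/ltW; exact: truncnS_gt.
    apply: (le_trans h1); rewrite -natrX ler_nat.
    by apply: leq_trans (leq_maxr M0 M1) _; apply/ltnW/ltn_expl.
  apply: (le_trans (step M e (leq_maxl _ _) e0)); rewrite mulrDr mulr1 lerD2l.
  have p2 : 0 < (2 : R) ^+ M by rewrite exprn_gt0.
  rewrite ler_pdivrMl // ler_pdivrMr // -ler_pdivrMl //.
  by rewrite mulrC.
have N0 : N <= 0.
  rewrite leNgt; apply/negP => Np.
  have V1 : 0 < V + 1 by rewrite ltr_wpDl.
  have := small (N / (V + 1) / 2); rewrite !divr_gt0 // => /(_ isT).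
  have -> : N / (V + 1) / 2 * (V + 1) = N / 2 by field; rewrite gt_eqF.
  lra.
have : N == 0 by rewrite eq_le N0 mulr_ge0 ?normc_ge0.
rewrite mulf_eq0 => /orP[/eqP/eq0_normc/eqP|/eqP/eq0_normc //].
by rewrite (negbTE factor_neq0).
Qed.

End HigherWeight.

(** * Density of the test functions *)

Section Rectangles.
Import numFieldNormedType.Exports.
Variable R : realType.
Local Notation constr := (seq bool * (bool * R))%type.

Definition rect (L : seq constr) : set (Xinf R) :=
  [set f | forall q, q \in L -> part q.2.1 (Xval f q.1) <= q.2.2].

Definition rect_system : set (set (Xinf R)) := [set E | exists L, E = rect L].

Lemma rect_cat L L' : rect (L ++ L') = rect L `&` rect L'.
Proof.
apply/seteqP; split=> f /=.
  by move=> h; split=> q qL; apply: h; rewrite mem_cat qL ?orbT.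
by move=> [h h'] q; rewrite mem_cat => /orP[/h|/h'].
Qed.

Lemma rect_nil : rect [::] = setT.
Proof. by apply/seteqP; split. Qed.

Lemma rect_system_setI : setI_closed rect_system.
Proof. by move=> _ _ [L ->] [L' ->]; exists (L ++ L'); rewrite rect_cat. Qed.

Lemma measurable_rect L : measurable (rect L).
Proof.
elim: L => [|q L ih]; first by rewrite rect_nil; exact: measurableT.
rewrite -cat1s rect_cat; apply: measurableI => //.
have mp := measurable_part q.2.1 (measurable_Xval q.1).
have -> : rect [:: q] = (fun f : Xinf R => part q.2.1 (Xval f q.1)) @^-1` `]-oo, q.2.2].
  apply/seteqP; split=> f /=; rewrite in_itv /=.
    by apply; rewrite inE.
  by move=> h r; rewrite inE => /eqP ->.
by rewrite -[X in measurable X]setTI; apply: mp => //; exact: measurable_itv.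
Qed.

Lemma rect_system_gen : @measurable _ (Xinf R) = <<s rect_system >>.
Proof.
apply/seteqP; split; last first.
  apply: smallest_sub; first exact: sigma_algebra_measurable.
  by move=> _ [L ->]; exact: measurable_rect.
pose T' := g_sigma_algebraType rect_system.
have mR e s : measurable_fun setT (fun f : T' => part e (Xval f s)).
  apply: (measurability _ (RGenOInfty.measurableE R)) => //.
  move=> _ [_ [b ->] <-]; rewrite setTI.
  have -> : (fun f : T' => part e (Xval f s)) @^-1` `]b, +oo[%classic =
      ~` rect [:: (s, (e, b))].
    apply/seteqP; split=> f /=; rewrite in_itv /= andbT.
      move=> bf /(_ (s, (e, b))); rewrite inE eqxx => /(_ isT) /=.
      by rewrite leNgt bf.
    move=> h; rewrite ltNge; apply/negP => fb; apply: h => q.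
    by rewrite inE => /eqP ->.
  apply: (@measurableC _ T'); apply: sub_sigma_algebra.
  by exists [:: (s, (e, b))].
have mC s : measurable_fun setT (fun f : T' => Xval f s).
  by apply/measurable_ReIm; split; [exact: (mR true)|exact: (mR false)].
have mX : @measurable_fun _ _ T' (power (seq bool) R[i]) setT (@Xval R).
  apply: (@measurability _ _ T' (power (seq bool) R[i]) setT _ (@coord_sets (seq bool) _ R[i])) => //.
  move=> _ [_ [s _ [Y mY <-]] <-]; rewrite !setTI.
  have := mC s measurableT Y mY; rewrite setTI.
  exact.
move=> _ [B mB <-]; have := mX measurableT B mB.
by rewrite setTI.
Qed.

Lemma psi_le0 (u : R) : u <= 0 -> psi u = 1.
Proof.
by move=> u0; rewrite /psi max_l // expr0n addr0 invr1.
Qed.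

Lemma testP_rect L n (f : Xinf R) : rect L f -> testP L n (Xval f) = 1.
Proof.
move=> fL; rewrite /testP big_seq big1 // => q qL; apply: psi_le0.
by apply: mulr_ge0_le0 => //; rewrite subr_le0; exact: fL.
Qed.

Lemma testP_norect L (f : Xinf R) : ~ rect L f ->
  (fun n => testP L n (Xval f)) @ \oo --> (0 : R).
Proof.
move=> /existsNP[q /not_implyP[qL /negP]]; rewrite -ltNge => hq.
set u := part q.2.1 (Xval f q.1) - q.2.2; have u0 : 0 < u by rewrite subr_gt0.
have le_psi n : testP L n (Xval f) <= psi (n%:R * u).
  rewrite /testP (big_rem q qL) /= -[leRHS]mulr1.
  have /andP[h0 h1] := testP_bounds (rem q L) n (Xval f).
  by have /andP[p0 p1] := psi_bounds (n%:R * u); rewrite ler_wpM2l // ltW.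
apply/cvgrPdist_le => e e0; near=> n.
have /andP[h0 h1] := testP_bounds L n (Xval f).
rewrite sub0r normrN ger0_norm //; apply: le_trans (le_psi n) _.
have nu0 : 0 <= n%:R * u by rewrite mulr_ge0 // ltW.
have en : e^-1 / u <= n%:R.
  by near: n; exact: nbhs_infty_ger.
have enu : e^-1 <= n%:R * u by rewrite -ler_pdivrMr.
have ei : 0 < e^-1 by rewrite invr_gt0.
have e1 : e * e^-1 = 1 by rewrite mulfV // gt_eqF.
rewrite /psi max_r // -[leRHS]invrK lef_pV2 ?posrE //; last first.
  by rewrite ltr_wpDr // sqr_ge0.
apply: le_trans enu _; have := sqr_ge0 (n%:R * u - 1); nra.
Unshelve. all: by end_near. Qed.

Variable gam : probability (Xinf R) R.

(** By dominated convergence the function integrates to zero over rectangles,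
    which form a pi-system that generates the sigma-algebra. *)
Lemma integrable_testP0 (g : Xinf R -> R) : gam.-integrable setT (EFin \o g) ->
  (forall L n, Rintegral gam setT (fun f => g f * testP L n (Xval f)) = 0) ->
  \forall f \ae gam, g f = 0.
Proof.
move=> ig g0; have mg : measurable_fun setT g.
  by apply/measurable_EFinP; case/integrableP : ig.
have mt L n : measurable_fun setT (fun f : Xinf R => testP L n (Xval f)).
  by apply: measurable_testP => s; exact: measurable_Xval.
have gt L n f : `|g f * testP L n (Xval f)| <= `|g f|.
  rewrite normrM -[leRHS]mulr1 ler_wpM2l //.
  by have /andP[h0 h1] := testP_bounds L n (Xval f); rewrite ger0_norm.
have igt L n : gam.-integrable setT (EFin \o (fun f => g f * testP L n (Xval f))).
  apply: (@le_integrableR _ _ _ gam _ (fun f => `|g f|)) => //.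
    exact: measurable_funM.
  exact: integrable_norm.
have rect0 L : (\int[gam]_(f in rect L) (g f)%:E = 0)%E.
  rewrite integral_mkcond.
  have mr : measurable_fun setT (fun f => ((EFin \o g) \_ (rect L)) f).
    apply/(measurable_restrictT _ (measurable_rect L)).
    by apply: measurable_funTS; exact/measurable_EFinP.
  have cvp f : [set: Xinf R] f -> (fun n => (g f * testP L n (Xval f))%:E) @ \oo -->
      ((EFin \o g) \_ (rect L)) f.
    move=> _; rewrite patchE; case: ifPn => fL.
      rewrite (_ : (fun n => _) = cst (g f)%:E); first exact: cvg_cst.
      by apply/funext => n; rewrite testP_rect ?mulr1 //; exact: set_mem.
    apply: cvg_EFin; first exact: nearW.
    have nL : ~ rect L f by move=> h; move: fL; rewrite mem_set.
    have := cvgM (cvg_cst (g f)) (testP_norect nL); rewrite mulr0.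
    exact.
  have [_ _ cv] := dominated_convergence measurableT
    (fun n => measurable_int _ (igt L n)) mr (aeW _ cvp) (integrable_norm ig)
    (aeW _ (fun f n (_ : setT f) => gt L n f)).
  have z : (fun n => \int[gam]_f (g f * testP L n (Xval f))%:E)%E = cst 0%E.
    apply/funext => n; rewrite -(fineK (integrable_fin_num measurableT (igt L n))).
    by have := g0 L n; rewrite /Rintegral /= => ->.
  rewrite z in cv; apply/esym.
  by apply: (cvg_unique _ (cvg_cst 0%E) cv).
have all0 E : measurable E -> (\int[gam]_(f in E) (g f)%:E = 0)%E.
  rewrite rect_system_gen => sE.
  apply: (dynkin_induction (P := fun E => (\int[gam]_(f in E) (g f)%:E = 0)%E)
    rect_system_gen rect_system_setI) sE.
  - by rewrite -rect_nil.
  - by move=> _ [L ->].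
  - move=> S mS S0.
    have := rect0 [::]; rewrite rect_nil -(setUv S) integral_setU //.
    + by rewrite S0 add0e.
    + exact: measurableC.
    + by apply: measurable_funTS; exact/measurable_EFinP.
    + by apply/disj_setPS => f [].
  - move=> F mF tF F0; rewrite integral_bigcup //.
      by rewrite eseries0.
    by apply: (integrableS _ _ (@subsetT _ _) ig) => //; exact: bigcup_measurable.
have := integral_ae_eq measurableT ig (measurable_cst 0%E).
move=> H; have : ae_eq gam setT (EFin \o g) (cst 0%E).
  apply: H => E _ mE; rewrite all0 //.
  by rewrite integral_cst // mul0e.
by apply: filterS => f /(_ I) [].
Qed.

Lemma L2_testP0 (w : Xinf R -> R[i]) : L2 gam w ->
  (forall L n, L2ip gam w (fun f => (testP L n (Xval f))%:C) = 0) ->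
  \forall f \ae gam, w f = 0.
Proof.
move=> wL w0.
have E (z : R[i]) (r : R) : complex.Re (z * (r%:C)^*) = complex.Re z * r /\
    complex.Im (z * (r%:C)^*) = complex.Im z * r.
  by case: z => a b /=; split; ring.
have L1 : L2 gam (fun=> 1%:C).
  by apply: (@real_L2 _ _ _ gam (fun=> 1) 1) => // f; rewrite normr1.
have [ir ii] := integrableC_mulJ wL L1.
have ir' : gam.-integrable setT (EFin \o (fun f => complex.Re (w f))).
  by apply: eq_integrable ir => // f _; rewrite (E _ _).1 mulr1.
have ii' : gam.-integrable setT (EFin \o (fun f => complex.Im (w f))).
  by apply: eq_integrable ii => // f _; rewrite (E _ _).2 mulr1.
have zr : \forall f \ae gam, complex.Re (w f) = 0.
  apply: integrable_testP0 => // L n.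
  have := congr1 (@complex.Re R) (w0 L n); rewrite /L2ip /cintegral /= => <-.
  by apply: eq_Rintegral => f _; rewrite (E _ _).1.
have zi : \forall f \ae gam, complex.Im (w f) = 0.
  apply: integrable_testP0 => // L n.
  have := congr1 (@complex.Im R) (w0 L n); rewrite /L2ip /cintegral /= => <-.
  by apply: eq_Rintegral => f _; rewrite (E _ _).2.
apply: filterS2 zr zi => f; case: (w f) => a b /= -> ->.
by [].
Qed.

End Rectangles.

(** * The spectral measures over single indices *)

Section SpectralMeasures.
Variables (R : realType) (lam : probability cantor R)
  (gam : probability (Xinf R) R)
  (alpha : (cantor -> R[i]) -> Xinf R -> Xinf R)
  (mu : forall x : idx, nat -> {finite_measure set (C_ x) -> \bar R}).
Hypothesis lamP : is_lambda lam.
Hypothesis act : boolean_action lam gam alpha.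
Hypothesis gammaP : is_gamma_inf gam.
Hypothesis muP : determines_spectral_form lam (koopman gam alpha) mu.

Lemma single_neq0 x m : single x m -> m != 0.
Proof.
move=> xm; apply/eqP => m0; have /andP[/eqP x0 _] := valP x.
by have := xm 0; rewrite x0 m0 eqxx.
Qed.

(** Otherwise the constant 1 over [x] would correspond to a nonzero vector
    orthogonal to all the test functions. *)
Lemma higher_weight_null x m : single x m -> m != 1 -> m != -1 ->
  mu x 0%N setT = 0%E.
Proof.
move=> xm m1 m1'; have m0 := single_neq0 xm.
have [U sm] := spectral_mapP act muP.
have [v vP] := local_preimage sm x.
have [d d1 dB] := circle_nonrootz R (absz m + 1).
have dm (j : int) : (absz j <= absz m + 1)%N -> j != 0 -> d ^ j != 1.
  by move=> jB; apply: contra => /eqP /(dB _ jB) ->.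
have vL t : L2 gam (v t) by exact: nonfixed_L2 (vP t).1.
have eig := local_eigen act sm xm vP.
have fac : diff_factor m d != 0.
  apply: second_difference_char => //; apply: dm; rewrite ?subr_eq0 ?addr_eq0 //.
  - by rewrite leq_addr.
  - rewrite -lez_nat abszE PoszD abszE; apply: le_trans (ler_normB _ _) _.
    by rewrite normr1.
  - rewrite -lez_nat abszE PoszD abszE; apply: le_trans (ler_normD _ _) _.
    by rewrite normr1.
have w0 := L2_testP0 (vL [::]) (ip_testP0 act gammaP vL eig d1
  (local_split sm xm vP) (local_norm_sum sm xm vP) fac).
have U0 := sm_norm0 sm (vP [::]).1 w0 (x, 0%N).
have : \forall a \ae mu x 0%N, False.
  apply: filterS2 U0 ((vP [::]).2 (x, 0%N)) => a -> /eqP.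
  rewrite /local_vec eqxx /= ifT ?inE // eq_sym oner_eq0.
  by [].
case=> N [mN N0 sN].
suff -> : setT = N by [].
by apply/esym/seteqP; split=> // a _; apply: sN.
Qed.

Lemma first_chaos_dominates x k : single x k -> k = -1 \/ k = 1 ->
  forall A, measurable A ->
  mu x 0%N [set a | forall p : D x, A (a p)] = 0%E -> lam A = 0%E.
Proof.
move=> xk k1 A mA A0; have [mu_compat mu_dom _] := muP.
have [U sm] := spectral_mapP act muP.
apply: (lambda_dominated lamP act gammaP mu_compat mu_dom sm k1 (xk := xk) mA).
rewrite -A0; congr (mu x 0%N _); apply/seteqP; split=> a /=.
  by move=> h p; rewrite (single_uniq xk p).
by move=> h; exact: h.
Qed.

End SpectralMeasures.

Theorem mainTheorem2 (R : realType)
    (lam : probability cantor R)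
    (gam : probability (Xinf R) R)
    (alpha : (cantor -> R[i]) -> Xinf R -> Xinf R)
    (mu : forall x : idx, nat -> {finite_measure set (C_ x) -> \bar R}) :
  is_lambda lam ->
  is_gamma_inf gam ->
  boolean_action lam gam alpha ->
  determines_spectral_form lam (koopman gam alpha) mu ->
  forall m : Zx,
    pushforward (mu x10 0%N) (@e_ x10 m) `<< mu (zmul m x10) 0%N
    <-> (val m = -1 \/ val m = 1).
Proof.
move=> lamP gammaP act muP m.
have xm := single_zmul m; have x1 := single_x10.
split=> [dom|mE].
  have [e|m1] := eqVneq (val m) 1; first by right.
  have [e|m1'] := eqVneq (val m) (-1); first by left.
  have z := higher_weight_null act gammaP muP xm m1 m1'.
  have /null_content_dominatesP h := dom.
  have z1 : mu x10 0%N setT = 0%E by have := h _ measurableT z.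
  have lT : lam setT = 0%E.
    apply: (first_chaos_dominates lamP act gammaP muP x1 (or_intror erefl) measurableT).
    by rewrite -z1; congr (mu x10 0%N _); apply/seteqP; split.
  by move: lT; rewrite probability_setT => /eqP; rewrite onee_eq0.
apply/null_content_dominatesP => B mB B0.
(* Over a single index a point is determined by its only coordinate, so that [B] is
   the preimage of a set of the Cantor space. *)
pose A : set cantor := [set a | B (fun=> a)].
have mdiag : measurable_fun setT (fun a : cantor => (fun=> a) : C_ (zmul m x10)).
  apply: (@measurability _ _ cantor (C_ (zmul m x10)) setT _
    (@coord_sets (D (zmul m x10)) _ cantor)) => //.
  by move=> _ [_ [p _ [Y mY <-]] <-]; rewrite !setTI.
have mA : measurable A by have := mdiag measurableT B mB; rewrite setTI.
have const (a : C_ (zmul m x10)) p : a = fun=> a p.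
  by apply/funext => q; rewrite (single_uniq xm q) (single_uniq xm p).
have A0 : lam A = 0%E.
  apply: (first_chaos_dominates lamP act gammaP muP xm mE mA).
  rewrite -[RHS]B0; congr (mu _ 0%N _); apply/seteqP; split=> a /=.
    by move=> /(_ (pt xm)); rewrite /A /= -const.
  by move=> Ba p; rewrite /A /= -const.
have [compat _ _] := muP; have [abs _ _] := compat x10 0%N.
have /null_content_dominatesP habs := abs (pt x1).
have := habs A mA A0.
have eE (a : C_ x10) : @e_ x10 m a = fun=> Defs.proj (pt x1) a.
  by apply/funext => q; rewrite /e_ /Defs.proj (single_uniq x1 [` _]%fset).
rewrite /pushforward => <-; congr (mu x10 0%N _).
by apply/seteqP; split=> a; rewrite /A /= eE.
Qed.
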